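(* Let $\gamma\in(0,1)$, $f\in L^2(0,T;\mathcal{V}')$, $\mathsf{u}_0\in\mathcal{H}$, and let $\mathsf{u}$ be the solution of the fractional evolution problem $\partial_t^\gamma\mathsf{u}+\mathfrak{F}\mathsf{u}=f$ on $(0,T)$, $\mathsf{u}(0)=\mathsf{u}_0$. Then $$I^{1-\gamma}\|\mathsf{u}\|_{\mathcal{H}}^2(T)+\|\mathsf{u}\|^2_{L^2(0,T;\mathcal{V})}\le I^{1-\gamma}\|\mathsf{u}_0\|_{\mathcal{H}}^2(T)+\|f\|^2_{L^2(0,T;\mathcal{V}')}.$$
   Context: $\mathcal{V}\subset\mathcal{H}\equiv\mathcal{H}'\subset\mathcal{V}'$ is a Gelfand triple of Hilbert spaces, $\mathfrak{F}:\mathcal{V}\to\mathcal{V}'$ is linear, continuous and coercive, $\langle\cdot,\cdot\rangle$ is the duality pairing between $\mathcal{V}$ and $\mathcal{V}'$; norms are $\|U\|_{\mathcal{H}}=(U,U)_{\mathcal{H}}^{1/2}$, $\|U\|_{\mathcal{V}}=\langle\mathfrak{F}U,U\rangle^{1/2}$, and $\|\cdot\|_{\mathcal{V}'}$ is the dual norm of $\|\cdot\|_{\mathcal{V}}$. The Caputo derivative is $\partial_t^\gamma\mathsf{u}(t)=\frac1{\Gamma(1-\gamma)}\int_0^t (t-r)^{-\gamma}\partial_r\mathsf{u}(r)\,dr$. For $\sigma>0$, $(I^\sigma g)(t)=\frac1{\Gamma(\sigma)}\int_0^t(t-r)^{\sigma-1}g(r)\,dr$; $I^{1-\gamma}\|\mathsf{u}\|_{\mathcal{H}}^2(T)$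 is $I^{1-\gamma}$ applied to $t\mapsto\|\mathsf{u}(t)\|_{\mathcal{H}}^2$, evaluated at $T$, and $I^{1-\gamma}\|\mathsf{u}_0\|_{\mathcal{H}}^2(T)$ is $I^{1-\gamma}$ applied to the constant $\|\mathsf{u}_0\|_{\mathcal{H}}^2$, evaluated at $T$. *)

(* Defs.v *)
From HB Require Import structures.
From mathcomp Require Import all_boot all_order all_algebra ring lra.
From mathcomp Require Import all_classical all_reals all_analysis.

Set Implicit Arguments.
Unset Strict Implicit.
Unset Printing Implicit Defensive.

Import Order.TTheory GRing.Theory Num.Theory.
Import numFieldNormedType.Exports.

Local Open Scope classical_set_scope.
Local Open Scope ring_scope.

HB.mixin Record isHilbert (R : realType) H & CompleteNormedModule R H := {
  inner : H -> H -> R ;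
  innerC : forall x y, inner x y = inner y x ;
  innerP : forall (a : R) x y z,
    inner (a *: x + y) z = a * inner x z + inner y z ;
  inner_norm : forall x, inner x x = `|x| ^+ 2
}.

#[short(type="hilbertType")]
HB.structure Definition Hilbert (R : realType) :=
  { H of isHilbert R H & CompleteNormedModule R H }.

Section inner_theory.
Context {R : realType} {H : hilbertType R}.
Implicit Types x y z : H.

Lemma innerDl x y z : inner (x + y) z = inner x z + inner y z.
Proof. by rewrite -[x]scale1r innerP mul1r scale1r. Qed.

Lemma inner0l y : inner 0 y = 0.
Proof.
have /eqP := innerDl 0 0 y; rewrite addr0 -subr_eq0 opprD addNKr oppr_eq0.
by move/eqP.
Qed.

Lemma innerZl a x y : inner (a *: x) y = a * inner x y.
Proof. by rewrite -[a *: x]addr0 innerP inner0l addr0. Qed.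

Lemma innerDr x y z : inner x (y + z) = inner x y + inner x z.
Proof. by rewrite innerC innerDl ![inner _ x]innerC. Qed.

Lemma innerZr a x y : inner x (a *: y) = a * inner x y.
Proof. by rewrite innerC innerZl innerC. Qed.

Lemma inner_CS x y : `|inner x y| <= `|x| * `|y|.
Proof.
have [->|x0] := eqVneq x 0; first by rewrite inner0l !normr0 mul0r.
have n0 : 0 < `|x| ^+ 2 by rewrite exprn_gt0 ?normr_gt0.
have := sqr_ge0 `|- inner x y *: x + `|x| ^+ 2 *: y|.
rewrite -inner_norm innerDl !innerDr !innerZl !innerZr [inner y x]innerC.
rewrite !inner_norm => h.
have {}h : 0 <= `|x| ^+ 2 * ((`|x| * `|y|) ^+ 2 - inner x y ^+ 2).
  apply: le_trans h _; rewrite le_eqVlt; apply/orP; left; apply/eqP.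
  by ring.
move: h; rewrite pmulr_rge0// subr_ge0 -real_normK ?num_real//.
by rewrite ler_sqr ?nnegrE ?mulr_ge0.
Qed.

End inner_theory.

Section dual.
Context {R : realType} (V : normedModType R).

Definition continuous_form : {pred V -> R} :=
  fun f => `[< linear f /\ continuous f >].

Record dual := Dual { dual_val :> V -> R ; _ : dual_val \in continuous_form }.

HB.instance Definition _ := [isSub for dual_val].
HB.instance Definition _ := [Choice of dual by <:].

Lemma continuous_form_submod_closed : submod_closed continuous_form.
Proof.
split.
  apply/asboolP; split; first by move=> a x y; rewrite /= scaler0 addr0.
  exact: cst_continuous.
move=> a f g /asboolP[lf cf] /asboolP[lg cg]; apply/asboolP; split.
  by move=> b x y; rewrite !fctE lf lg /GRing.scale/=; ring.
by move=> x; apply: cvgD; [apply: cvgZr; exact: cf | exact: cg].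
Qed.

HB.instance Definition _ := GRing.isSubmodClosed.Build _ _ continuous_form
  continuous_form_submod_closed.
HB.instance Definition _ := [SubChoice_isSubLmodule of dual by <:].

(** [N] need not be the norm of [V]: it will be the energy norm below. *)
Definition dual_norm (N : V -> R) (l : dual) : R :=
  sup [set `|l v| | v in [set v | N v <= 1]].

Lemma dual_linear (l : dual) : linear l.
Proof. by case: l => l /= /asboolP[]. Qed.

Lemma dual_continuous (l : dual) : continuous (l : V -> R).
Proof. by case: l => l /= /asboolP[]. Qed.

Lemma dualD (l m : dual) v : (l + m) v = l v + m v.
Proof. by []. Qed.

Lemma dualZ a (l : dual) v : (a *: l) v = a * l v.
Proof. by []. Qed.

HB.instance Definition _ (l : dual) :=
  GRing.isLinear.Build R V R _ l (dual_linear l).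

Let ball1 : set V := [set v | `|v| <= 1].

Let dual_bounded (l : dual) : has_ubound [set `|l v| | v in ball1].
Proof.
have /linear_boundedP/pinfty_ex_gt0[M M0 lM] :=
  continuous_linear_bounded 0 (@dual_continuous l 0).
by exists M => _ [v v1 <-]; apply: le_trans (lM v) _; rewrite ler_piMr// ltW.
Qed.

Let ball1_nonempty (l : dual) : [set `|l v| | v in ball1] !=set0.
Proof. by exists `|l 0|, 0 => //; rewrite /ball1/= normr0. Qed.

Let dual_le (l : dual) v : `|v| <= 1 -> `|l v| <= dual_norm Num.norm l.
Proof. by move=> v1; apply: ub_le_sup => //; exists v. Qed.

Let dual_norm_ge0 (l : dual) : 0 <= dual_norm Num.norm l.
Proof. by apply: le_trans (@dual_le l 0 _); rewrite ?normr0. Qed.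

Let dual_normD (l m : dual) :
  dual_norm Num.norm (l + m) <= dual_norm Num.norm l + dual_norm Num.norm m.
Proof.
apply: ge_sup => // _ [v v1 <-].
by rewrite dualD (le_trans (ler_normD _ _))// lerD// dual_le.
Qed.

Let dual_normZ_le a (l : dual) :
  dual_norm Num.norm (a *: l) <= `|a| * dual_norm Num.norm l.
Proof.
apply: ge_sup => // _ [v v1 <-].
by rewrite dualZ normrM ler_wpM2l// dual_le.
Qed.

Let dual_normZ a (l : dual) :
  dual_norm Num.norm (a *: l) = `|a| * dual_norm Num.norm l.
Proof.
apply/eqP; rewrite eq_le dual_normZ_le/=.
have [->|a0] := eqVneq a 0; first by rewrite normr0 mul0r.
rewrite -ler_pdivlMl ?normr_gt0// -normfV.
by apply: le_trans (dual_normZ_le _ _); rewrite scalerA mulVf// scale1r.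
Qed.

Let dual_norm0_eq0 (l : dual) : dual_norm Num.norm l = 0 -> l = 0.
Proof.
move=> l0; apply/val_inj/funext => v /=.
have [->|v0] := eqVneq v 0; first by rewrite linear0.
have /(@dual_le l) : `| `|v|^-1 *: v | <= 1.
  by rewrite normrZ normfV normr_id mulVf// normr_eq0.
rewrite l0 linearZ/= normr_le0 mulf_eq0 invr_eq0 normr_eq0 (negPf v0)/=.
by move/eqP.
Qed.

(** [`|l|] on [dual V] is the operator norm *)
HB.instance Definition _ := Lmodule_isNormed.Build R dual
  dual_normD dual_normZ dual_norm0_eq0.

End dual.

Record gelfand (R : realType) (V H : hilbertType R) := Gelfand {
  emb :> {linear V -> H} ;
  emb_continuous : continuous emb ;
  emb_inj : injective emb ;
  emb_dense : dense (range emb)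
}.

Section gelfand_theory.
Context {R : realType} {V H : hilbertType R}.
Implicit Types (G : gelfand V H) (F : V -> dual V).

Lemma pivot_subproof G (h : H) : (fun v => inner h (G v)) \in @continuous_form R V.
Proof.
have lin : linear (fun v => inner h (G v)).
  by move=> a x y; rewrite linearP innerDr innerZr.
apply/asboolP; split => //.
pose l : {linear V -> R} := HB.pack (fun v => inner h (G v))
  (GRing.isLinear.Build R V R _ _ lin).
have /linear_boundedP/pinfty_ex_gt0[M M0 GM] :=
  continuous_linear_bounded 0 (@emb_continuous _ _ _ G 0).
apply: (@bounded_linear_continuous _ _ _ l); apply/linear_boundedP.
near=> r => v /=; apply: le_trans (inner_CS _ _) _.
apply: le_trans (ler_wpM2l (normr_ge0 _) (GM v)) _.
rewrite mulrA ler_wpM2r//; near: r; apply: nbhs_pinfty_ge.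
Unshelve. all: by end_near. Qed.

(** the embedding [H = H' -> V'], i.e. [<pivot G h, v> = (h, v)_H] *)
Definition pivot G (h : H) : dual V := Dual (pivot_subproof G h).

Definition coercive F := exists2 a : R, 0 < a & forall v, a * `|v| ^+ 2 <= F v v.

(** [|U|_V = <F U, U>^(1/2)] *)
Definition energy_norm F (v : V) : R := Num.sqrt (F v v).

End gelfand_theory.

Section fractional.
Context {R : realType}.
Local Notation mu := (@lebesgue_measure R).

Definition Gamma (s : R) : R :=
  \int[mu]_(t in `]0, +oo[) (t `^ (s - 1) * expR (- t)).

(** The left-sided integral [I^s g], only meant for [g >= 0]; it may be [+oo] *)
Definition fracint (s : R) (g : R -> R) (t : R) : \bar R :=
  ((Gamma s)^-1%:E *
   \int[mu]_(r in `]0%R, t[) ((t - r) `^ (s - 1) * g r)%:E)%E.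

(** The right-sided integral, the transpose of [g |-> I^s g] on [(0, T)]:
    [\int_0^T (I^s g) phi = \int_0^T g (fracint_right s T phi)]. *)
Definition fracint_right (s T : R) (phi : R -> R) (r : R) : R :=
  (Gamma s)^-1 * \int[mu]_(t in `]r, T[) ((t - r) `^ (s - 1) * phi t).

(** C^1 test functions on [[0, T]] vanishing at [T], but not necessarily at 0 *)
Definition test_function (T : R) (phi : R -> R) : Prop :=
  [/\ forall t, derivable phi t 1, continuous (derive1 phi) & phi T = 0].

(** The distributional derivative of [g] on [[0, T)] with [g(0) = g0],
    tested against [psi] with [psi T = 0]:
    [\int_0^T g' psi = - g0 psi(0) - \int_0^T g psi'
                     = - \int_0^T (g - g0) psi'] *)
Definition dist_derive (T : R) (g : R -> R) (g0 : R) (psi : R -> R) : R :=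
  - \int[mu]_(r in `]0, T[) ((g r - g0) * derive1 psi r).

End fractional.

Section bochner.
Context {R : realType} {X : normedModType R}.
Local Notation mu := (@lebesgue_measure R).

Definition simple_function (s : R -> X) : Prop :=
  finite_set (range s) /\ forall x, measurable (s @^-1` [set x]).

Definition strongly_measurable (D : set R) (f : R -> X) : Prop :=
  exists2 s : nat -> R -> X, forall n, simple_function (s n) &
    {ae mu, forall t, D t -> s n t @[n --> \oo] --> f t}.

(** [|f|^2] in [L^2(0, T; X)] when [X] is normed by [N] *)
Definition sqr_L2norm (T : R) (N : X -> R) (f : R -> X) : \bar R :=
  (\int[mu]_(t in `]0%R, T[) (N (f t) ^+ 2)%:E)%E.

Definition in_L2 (T : R) (N : X -> R) (f : R -> X) : Prop :=
  strongly_measurable `]0, T[ f /\ (sqr_L2norm T N f < +oo)%E.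

End bochner.

Section evolution.
Context {R : realType} {V H : hilbertType R}.
Local Notation mu := (@lebesgue_measure R).

(** [w] is the Caputo derivative
      [1 / Gamma (1 - gamma) * \int_0^t (t - r)^(- gamma) g'(r) dr]
    of [g : (0, T) -> V'] with [g(0) = g0].  For f in L^2(0, T; V') and u0 in H
    the solution is in general not weakly differentiable in the L^1 sense, nor
    continuous at 0 in V', so [g'] is the distribution [dist_derive], which
    carries the initial value, and [I^(1 - gamma)] acts on it by transposition.
    If g is absolutely continuous with integrable [g'] and [g(0) = g0], then
    (Fubini and one integration by parts) w is a.e. given by the formula. *)
Definition is_caputo (gamma T : R) (g : R -> dual V) (g0 : dual V)
    (w : R -> dual V) : Prop :=
  forall (v : V) (phi : R -> R), test_function T phi ->
    \int[mu]_(t in `]0, T[) (w t v * phi t) =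
    dist_derive T (fun r => g r v) (g0 v) (fracint_right (1 - gamma) T phi).

Definition is_solution (G : gelfand V H) (F : V -> dual V) (gamma T : R)
    (f : R -> dual V) (u0 : H) (u : R -> V) : Prop :=
  in_L2 T (energy_norm F) u /\
  exists w : R -> dual V,
    [/\ in_L2 T (dual_norm (energy_norm F)) w,
        is_caputo gamma T (fun t => pivot G (G (u t))) (pivot G u0) w &
        {ae mu, forall t, t \in `]0, T[ -> w t + F (u t) = f t}].

End evolution.

(* Main.v *)
Require Import Defs.
From mathcomp Require Import all_boot all_order all_algebra ring lra.
From mathcomp Require Import all_classical all_reals all_analysis.
From mathcomp Require Import measurable_realfun.
Set Implicit Arguments.
Unset Strict Implicit.
Unset Printing Implicit Defensive.
Import Order.TTheory GRing.Theory Num.Theory.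
Import numFieldNormedType.Exports.
Local Open Scope classical_set_scope.
Local Open Scope ring_scope.

(** The estimate is the limit of a chain rule for a regularised kernel.  Let
    k(t) = t^(-gamma) / Gamma(1 - gamma), W = <w, .> and g = (Gu - u0, .).  With
    j_n(t) = t^(gamma - 1) exp(- n t) normalised by \int_0^T j_n = 1, the kernel
    kappa_n = k * j_n is kappa_n(0+) - \int_0^t nu_n with nu_n >= 0, so the weak
    Caputo equation becomes
      j_n * W_v = kappa_n(0+) g_v - nu_n * g_v   a.e. on (0, T), for all v.
    Taking v = u(t) and using nu_n >= 0, kappa_n >= 0 and Young's inequality,
      2 (j_n * W_{u(t)})(t) >=
        kappa_n(0+) |u(t)|^2 - (nu_n * |u|^2)(t) - kappa_n(t) |u0|^2,
    and integrating over (0, T), as \int_0^T kappa_n <= \int_0^T k,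
      (kappa_n * |u|^2)(T) <= |u0|^2 \int_0^T k + 2 \int_0^T (j_n * W_{u(t)})(t) dt.
    Since j_n is an approximate identity, the last integral tends to
    \int_0^T <w, u>; on the left one uses kappa_n >= k \int_0^t j_n, k being
    decreasing, and Fatou's lemma.  Finally, with w = f - F u,
    2 <w, u> = 2 <f, u> - 2 |u|_V^2 <= |f|_V'^2 - |u|_V^2.

    [u] and [w] are replaced by everywhere limits of simple functions; |f|_V'^2
    need not be measurable, but only monotonicity of its integral is used. *)

(** Neither [u] nor its image in H need have a time derivative, and [u] is not a test function, so
    no chain rule applies to the Caputo derivative itself. For a kernel with a finite value at 0+
    and a nonpositive derivative, the chain rule becomes an algebraic inequality between
    convolutions.

    The exponent gamma - 1 of j_n is the one for which the powers of t in k * j_n cancel: after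
    scaling, kappa_n(t) is a constant times \int_0^1 (1 - s)^(- gamma) s^(gamma - 1) exp(- n t s)
    ds. This is a superposition of decaying exponentials, from which kappa_n(0+) < oo and nu_n >= 0
    are read off.

    The equation enters only through the scalar functions W_v and g_v, so that no vector-valued
    integral occurs. The price is a null set depending on v, removed by continuity in v before v =
    u(t) is inserted. Moreover, in j_n * W_{u(t)} the vector is frozen at time t while w runs over
    the past, so L^1 convergence for fixed v is not enough: u is compared with a function of
    finitely many values, and the error is absorbed by a weighted Young inequality. *)

Section change_of_variables.
Context {R : realType}.
Local Notation mu := (@lebesgue_measure R).
Local Open Scope ereal_scope.

Lemma measurable_affine (a b : R) :
  measurable_fun [set: measurableTypeR R] (fun x => a * x + b : measurableTypeR R)%R.
Proof. by apply: measurable_funD => //; apply: measurable_funM. Qed.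

(** Both sides are measures in [A], so uniqueness of Lebesgue measure reduces the claim to intervals
    []x, y]]. For [a < 0] the preimage is closed on the left and open on the right, which has the
    same length. *)
Lemma lebesgue_measure_affine (a b : R) (A : set R) : (a != 0)%R ->
  measurable A ->
  mu A = `|a|%:E * mu ((fun x => a * x + b)%R @^-1` A).
Proof.
move=> a0 mA.
pose s : {nonneg R} := NngNum (normr_ge0 a).
have maff := measurable_affine a b.
rewrite [RHS](_ : _ = mscale s
  (pushforward mu ((fun x => a * x + b)%R : _ -> measurableTypeR R)) A)//.
apply: lebesgue_measure_unique => //= _ [[x y]] _ <-.
rewrite /mscale/= /pushforward.
have [a_lt0|a_gt0|/eqP] := ltgtP a 0%R; last by rewrite (negPf a0).
  rewrite (_ : _ @^-1` _ = `[(y - b) / a, (x - b) / a[%classic)%R.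
    rewrite !lebesgue_measure_itv/= !lte_fin (ltr_ndivrMr _ _ a_lt0).
    rewrite divfK// ltrD2r.
    case: ifPn => xy; last by rewrite mule0.
    by rewrite ltr0_norm// -!EFinD -EFinM; congr EFin; field.
  by apply/seteqP; split => z /=; rewrite !in_itv/= ler_ndivrMr// ltr_ndivlMr//;
    move=> /andP[h1 h2]; apply/andP; split; lra.
rewrite (_ : _ @^-1` _ = `](x - b) / a, (y - b) / a]%classic)%R.
  rewrite !lebesgue_measure_itv/= !lte_fin (ltr_pdivrMr _ _ a_gt0).
  rewrite divfK// ltrD2r.
  case: ifPn => xy; last by rewrite mule0.
  by rewrite gtr0_norm// -!EFinD -EFinM; congr EFin; field.
by apply/seteqP; split => z /=; rewrite !in_itv/= ltr_pdivrMr// ler_pdivlMr//;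
  move=> /andP[h1 h2]; apply/andP; split; lra.
Qed.

Lemma ge0_integral_affine (a b : R) (f : R -> \bar R) : (a != 0)%R ->
  measurable_fun setT f -> (forall x, 0 <= f x) ->
  \int[mu]_x f x = `|a|%:E * \int[mu]_x f (a * x + b)%R.
Proof.
move=> a0 mf f0.
pose s : {nonneg R} := NngNum (normr_ge0 a).
have maff := measurable_affine a b.
rewrite (_ : \int[mu]_x f (a * x + b)%R =
    \int[pushforward mu ((fun x => a * x + b)%R : _ -> measurableTypeR R)]_x f x).
  rewrite -[`|a|%:E]/(s%:num%:E) -ge0_integral_mscale//.
  apply: eq_measure_integral => A mA _.
  by rewrite /= /mscale/= /pushforward -lebesgue_measure_affine.
by rewrite ge0_integral_pushforward//= preimage_setT.
Qed.

Lemma integral_reflect (c : R) (f : R -> \bar R) :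
  measurable_fun setT f -> \int[mu]_x f x = \int[mu]_x f (c - x)%R.
Proof.
move=> mf; rewrite integralE [RHS]integralE.
rewrite (@ge0_integral_affine (-1) c f^\+) ?oppr_eq0//; last exact: measurable_funepos.
rewrite (@ge0_integral_affine (-1) c f^\-) ?oppr_eq0//; last exact: measurable_funeneg.
rewrite normrN1 !mul1e.
have E x : (-1 * x + c = c - x)%R by lra.
by congr (_ - _); apply: eq_integral => x _; rewrite E ?funeposE ?funenegE.
Qed.

End change_of_variables.

(** * Convolution of locally integrable functions on the half-line *)

Section convolution.
Context {R : realType}.
Local Notation mu := (@lebesgue_measure R).
Implicit Types (a w p q : R -> R) (b c t s x : R).

Definition prim a x : R := \int[mu]_(t in `]-oo, x]) a t.

Definition conv a w t : R := \int[mu]_s (a (t - s) * w s).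

(** For causal [a] and [w], [prim a x] is \int_0^x a and [conv a w t] is
    \int_0^t a(t - s) w(s) ds. *)
Definition causal a : Prop :=
  [/\ measurable_fun setT a, forall x, x <= 0 -> a x = 0 &
      forall x, mu.-integrable `]-oo, x] (EFin \o a)].

Lemma integrable_reflect c (f : R -> \bar R) :
  mu.-integrable setT f -> mu.-integrable setT (fun x => f (c - x)).
Proof.
move=> /integrableP[mf foo]; apply/integrableP; split.
  by apply: (measurableT_comp mf); apply: measurable_funB.
rewrite -(@integral_reflect _ c (abse \o f))//.
exact: measurableT_comp.
Qed.

Lemma measurable_conv_kernel p q : measurable_fun setT p ->
  measurable_fun setT q ->
  measurable_fun [set: measurableTypeR R * measurableTypeR R]
    (fun z => p (z.1 - z.2) * q z.2).
Proof.
move=> mp mq; apply: measurable_funM; last exact: measurableT_comp.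
by apply: (measurableT_comp mp); apply: measurable_funB.
Qed.

Lemma ge0_integral_shift s (f : R -> \bar R) : measurable_fun setT f ->
  (forall x, 0 <= f x)%E ->
  (\int[mu]_x f (x - s)%R = \int[mu]_x f x)%E.
Proof.
move=> mf f0; rewrite [RHS](@ge0_integral_affine _ 1 (- s))// normr1 mul1e.
by apply: eq_integral => x _; rewrite mul1r.
Qed.

(** Tonelli and translation invariance of the inner integral: the double integral of the modulus is
    the product of the two L^1 norms. *)
Lemma integrable_conv_kernel p q : mu.-integrable setT (EFin \o p) ->
  mu.-integrable setT (EFin \o q) ->
  (mu \x mu)%E.-integrable setT (fun z => (p (z.1 - z.2) * q z.2)%:E).
Proof.
move=> /integrableP[mp poo] /integrableP[mq qoo].
have {}mp : measurable_fun setT p by exact/measurable_EFinP.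
have {}mq : measurable_fun setT q by exact/measurable_EFinP.
apply/integrable21ltyP.
  by apply/measurable_EFinP; exact: measurable_conv_kernel.
rewrite (_ : (fun _ => _) = (fun y => (\int[mu]_x `|(p x)%:E|) * `|(q y)%:E|)%E).
  rewrite ge0_integralZl//.
  - rewrite lte_mul_pinfty//; first exact: integral_ge0.
    by rewrite ge0_fin_numE//; exact: integral_ge0.
  - by apply: measurableT_comp => //; exact/measurable_EFinP.
  - exact: integral_ge0.
apply/funext => y /=.
under eq_integral do rewrite normrM EFinM.
rewrite ge0_integralZr//.
- rewrite (@ge0_integral_shift y (fun x => `|(p x)%:E|)%E)//.
  by apply: measurableT_comp => //; exact/measurable_EFinP.
- apply/measurable_EFinP; apply: measurableT_comp => //.
  by apply: (measurableT_comp mp); apply: measurable_funB.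
Qed.

Lemma convC a w : measurable_fun setT a -> measurable_fun setT w ->
  conv a w = conv w a.
Proof.
move=> ma mw; apply/funext => t; rewrite /conv /Rintegral; congr fine.
rewrite (@integral_reflect _ t)/=.
  by apply: eq_integral => s _; rewrite opprB addrCA subrr addr0 mulrC.
apply/measurable_EFinP; apply: measurable_funM => //.
by apply: (measurableT_comp ma); apply: measurable_funB.
Qed.

(** Causal functions are integrable only on half-lines bounded above. Cutting both factors at [b]
    makes them integrable on the whole line and leaves [conv a w t] unchanged for [t <= b]. *)
Definition upto b a : R -> R := a \_ `]-oo, b].

Lemma uptoE b a x : upto b a x = if x <= b then a x else 0.
Proof. by rewrite /upto patchE mem_setE in_itv/=. Qed.

Let mle {x} : measurable (`]-oo, x]%classic : set R).
Proof. exact: measurable_itv. Qed.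

Lemma integrable_upto b a : causal a -> mu.-integrable setT (EFin \o upto b a).
Proof.
move=> [ma a0 ia].
rewrite /upto -restrict_EFin.
exact: (@integrable_mkcond _ _ _ mu _ (EFin \o a) (@mle b)).1 (ia b).
Qed.

Lemma causal_mul_upto a w b t s : causal a -> causal w -> t <= b ->
  a (t - s) * w s = upto b a (t - s) * upto b w s.
Proof.
move=> [_ a0 _] [_ w0 _] tb; rewrite !uptoE.
have [s0|s0] := leP s 0; first by rewrite w0// if_same !mulr0.
have [ts|ts] := leP (t - s) 0; first by rewrite a0// if_same !mul0r.
by rewrite !ifT//; lra.
Qed.

Lemma causal_mul_itv a w b t s : causal a -> causal w ->
  upto (b - s) a (t - s) * w s =
  (if t <= b then upto b a (t - s) * upto b w s else 0).
Proof.
move=> ca cw; rewrite uptoE lerD2r; case: ifPn => tb; last by rewrite mul0r.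
exact: causal_mul_upto.
Qed.

(** The cut-offs at the integers produce countably many null sets; at a given [t], any integer above
    [t] may be used. *)
Lemma ae_integrable_conv a w : causal a -> causal w ->
  {ae mu, forall t, mu.-integrable setT (fun s => (a (t - s) * w s)%:E)}.
Proof.
move=> ca cw.
have H (n : nat) : {ae mu, forall t, mu.-integrable setT
    (fun s => (upto n%:R a (t - s) * upto n%:R w s)%:E)}.
  have X := ae_integrable1 (integrable_conv_kernel (integrable_upto n%:R ca)
    (integrable_upto n%:R cw)).
  exact X.
have {}H : {ae mu, forall t, forall n : nat, mu.-integrable setT
    (fun s => (upto n%:R a (t - s) * upto n%:R w s)%:E)}.
  by apply/ae_foralln => n; exact: H.
apply: filterS H; first exact: (ae_filter_ringOfSetsType mu).
move=> t /(_ (Num.truncn t).+1).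
apply: eq_integrable => // s _ /=; rewrite -causal_mul_upto//.
by rewrite ltW// truncnS_gt.
Qed.

Let fub b a w t := (\int[mu]_s (upto b a (t - s) * upto b w s)%:E)%E.

Let conv_fub b a w t : causal a -> causal w -> t <= b ->
  conv a w t = fine (fub b a w t).
Proof.
move=> ca cw tb; rewrite /conv /Rintegral /fub; congr fine.
by apply: eq_integral => s _; rewrite (causal_mul_upto _ ca cw tb).
Qed.

Let integrable_fub b a w : causal a -> causal w ->
  mu.-integrable setT (fub b a w).
Proof.
move=> ca cw.
exact: (integrable_fubini_F (integrable_conv_kernel (integrable_upto b ca)
  (integrable_upto b cw))).
Qed.

Lemma integrable_fine (D : set R) (f : R -> \bar R) : measurable D ->
  mu.-integrable D f -> mu.-integrable D (EFin \o (fine \o f)).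
Proof.
move=> mD fi; apply: le_integrable (fi) => //.
  apply/measurable_EFinP; apply: measurableT_comp => //.
  exact: (measurable_int _ fi).
by move=> x _ /=; case: (f x) => [r||] /=; rewrite ?lexx ?leey.
Qed.

Lemma causal_conv a w : causal a -> causal w -> causal (conv a w).
Proof.
move=> ca cw; split.
(* Once [n >= t] the cut-off at [n] no longer changes the value at [t], so [conv a w] is a pointwise
   limit of measurable functions. *)
- apply: (@measurable_fun_cvg _ _ _ setT (fun n : nat => fine \o fub n%:R a w)).
    move=> n; apply: measurableT_comp => //.
    exact: (measurable_int _ (integrable_fub _ ca cw)).
  move=> t _; apply: cvg_near_cst; near=> n; rewrite /= (@conv_fub n%:R)//.
  by near: n; exact: nbhs_infty_ger.
- move=> t t0; rewrite /conv /Rintegral integral0_eq// => s _.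
  case: ca cw => _ a0 _ [_ w0 _].
  have [s0|s0] := leP s 0; first by rewrite w0// mulr0.
  by rewrite a0 ?mul0r//; lra.
- move=> x.
  have := integrable_fine (@mle x) (@integrableS _ _ _ mu setT _ _ measurableT
    (@mle x) (@subsetT _ _) (integrable_fub x ca cw)).
  apply: eq_integrable => // t; rewrite inE/= in_itv/= => tx.
  by rewrite (conv_fub ca cw tx).
Unshelve. all: by end_near. Qed.

Lemma integral_shift s (f : R -> \bar R) : measurable_fun setT f ->
  (\int[mu]_x f (x - s)%R = \int[mu]_x f x)%E.
Proof.
move=> mf; rewrite [RHS](integral_reflect 0)// [RHS](integral_reflect s).
  by apply: eq_integral => x _; congr f; lra.
by apply: (measurableT_comp mf); apply: measurable_funB.
Qed.

(** [prim] is convolution with the indicator of the positive half-line, so this is a case of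
    associativity, hence of Fubini. *)
Lemma prim_conv a w : causal a -> causal w -> prim (conv a w) = conv (prim a) w.
Proof.
move=> ca cw; apply/funext => b; rewrite /prim /Rintegral.
(* [conv] is a [fine] value and agrees with [fub] only where the latter is finite, that is almost
   everywhere. *)
transitivity (fine (\int[mu]_(t in `]-oo, b]) fub b a w t)%E).
  congr fine; apply: ae_eq_integral => //.
  - apply/measurable_EFinP; apply: measurable_funTS.
    by case: (causal_conv ca cw).
  - apply: measurable_funTS; exact: (measurable_int _ (integrable_fub _ ca cw)).
  - have := integrable_ae measurableT (integrable_fub b ca cw).
    apply: filterS.
    move=> t /(_ Logic.I) tfin /=; rewrite in_itv/= => tb.
    by rewrite (conv_fub ca cw tb) fineK.
rewrite /conv /Rintegral; congr fine.
(* Cutting [a] at [b - z.2] encodes the region [t <= b]; the inner integral over [t] is then a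
   translate and equals [prim a (b - s)]. *)
pose K (z : R * R) := (upto (b - z.2) a (z.1 - z.2) * w z.2)%:E.
have iK : (mu \x mu)%E.-integrable setT K.
  have i0 := integrable_conv_kernel (integrable_upto b ca) (integrable_upto b cw).
  rewrite (_ : K = (fun z => (upto b a (z.1 - z.2) * upto b w z.2)%:E)
      \_ (`]-oo, b]%classic `*` setT)).
    apply: (integrable_mkcond _ _).1; first exact: measurableX.
    by apply: integrableS i0 => //; exact: measurableX.
  apply/funext => -[t s]; rewrite /K/= causal_mul_itv// patchE.
  have [tb|tb] := boolP (t <= b); last by rewrite memNset//= in_itv/= (negPf tb) => -[].
  by rewrite mem_set//=; split=> //; rewrite /= in_itv.
have := Fubini iK.
rewrite [LHS](_ : _ = \int[mu]_(t in `]-oo, b]) fub b a w t)%E; last first.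
  rewrite [RHS]integral_mkcond; apply: eq_integral => t _ /=.
  rewrite patchE mem_setE in_itv/= /K/=.
  under eq_integral do rewrite causal_mul_itv//.
  by case: ifPn => // _; rewrite integral0.
move=> ->; apply: eq_integral => s _.
rewrite /K/=; under eq_integral do rewrite EFinM.
have iu := integrable_upto (b - s) ca.
have iu' : mu.-integrable setT (fun t => (upto (b - s) a (t - s))%:E).
  have := integrable_reflect s (integrable_reflect 0 iu).
  by apply: eq_integrable => // t _; rewrite /=; congr (upto _ _ _)%:E; lra.
rewrite integralZr//.
rewrite (integral_shift s (measurable_int _ iu)) EFinM; congr (_ * _)%E.
rewrite /prim /Rintegral fineK.
  rewrite [RHS]integral_mkcond; apply: eq_integral => t _.
  by rewrite /= /upto restrict_EFin.
apply: integrable_fin_num => //; by case: ca.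
Qed.

End convolution.

(** * Primitives of causal functions and their differentiation *)

Section causal_theory.
Context {R : realType}.
Local Notation mu := (@lebesgue_measure R).
Implicit Types (a w e p : R -> R) (b c r t s x T M : R).

Let mle {x} : measurable (`]-oo, x]%classic : set R).
Proof. exact: measurable_itv. Qed.

Lemma causalD a w : causal a -> causal w -> causal (fun x => a x + w x).
Proof.
move=> [ma a0 ia] [mw w0 iw]; split.
- exact: measurable_funD.
- by move=> x x0; rewrite a0// w0// addr0.
- by move=> x; apply: (integrableD _ (ia x) (iw x)); exact: mle.
Qed.

Lemma causalZ r a : causal a -> causal (fun x => r * a x).
Proof.
move=> [ma a0 ia]; split.
- exact: measurable_funM.
- by move=> x x0; rewrite a0// mulr0.
- by move=> x; apply: (integrableZl _ r (ia x)); exact: mle.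
Qed.

Lemma causalB a w : causal a -> causal w -> causal (fun x => a x - w x).
Proof.
move=> ca cw; rewrite (_ : (fun _ => _) = (fun x => a x + (-1) * w x)).
  by apply: causalD => //; exact: causalZ.
by apply/funext => x; rewrite mulN1r.
Qed.

Lemma primZ r a x : causal a -> prim (fun x => r * a x) x = r * prim a x.
Proof. by move=> [_ _ ia]; rewrite /prim RintegralZl//; exact: mle. Qed.

Lemma primD a w x : causal a -> causal w ->
  prim (fun x => a x + w x) x = prim a x + prim w x.
Proof. by move=> [_ _ ia] [_ _ iw]; rewrite /prim RintegralD//; exact: mle. Qed.

Lemma primB a w x : causal a -> causal w ->
  prim (fun x => a x - w x) x = prim a x - prim w x.
Proof. by move=> [_ _ ia] [_ _ iw]; rewrite /prim RintegralB//; exact: mle. Qed.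

Lemma RintegralN (D : set R) (f : R -> R) :
  \int[mu]_(x in D) - f x = - \int[mu]_(x in D) f x.
Proof.
rewrite /Rintegral integralE [in RHS]integralE.
rewrite (_ : (fun x => (- f x)%:E)^\+ = (fun x => (f x)%:E)^\-)%E; last first.
  by apply/funext => x; rewrite funeposE funenegE EFinN.
rewrite (_ : (fun x => (- f x)%:E)^\- = (fun x => (f x)%:E)^\+)%E; last first.
  by apply/funext => x; rewrite funeposE funenegE EFinN oppeK.
have := @integral_ge0 _ _ _ mu D (fun x => (f x)%:E)^\+%E (fun _ _ => funepos_ge0 _ _).
have := @integral_ge0 _ _ _ mu D (fun x => (f x)%:E)^\-%E (fun _ _ => funeneg_ge0 _ _).
(* If one of the two parts is infinite, [fine] returns 0 on both sides. *)
case: (integral _ _ _) => [p||] // _; case: (integral _ _ _) => [q||] //= _.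
- by rewrite opprB.
- by rewrite oppr0.
- by rewrite oppr0.
- by rewrite oppr0.
Qed.

Lemma prim_le0 a x : causal a -> x <= 0 -> prim a x = 0.
Proof.
move=> [_ a0 _] x0; rewrite /prim /Rintegral integral0_eq// => t/=.
by rewrite in_itv/= => tx; rewrite a0//; lra.
Qed.

Lemma prim_ge0 a x : (forall t, 0 <= a t) -> 0 <= prim a x.
Proof. by move=> a0; apply: Rintegral_ge0. Qed.

Lemma prim_itv l a x : causal a -> l <= 0 -> prim a x = \int[mu]_(t in `[l, x]) a t.
Proof.
move=> [_ a0 _] l0; rewrite /prim Rintegral_mkcond [RHS]Rintegral_mkcond.
apply: eq_Rintegral => t _; rewrite !patchE !mem_setE !in_itv/=.
by have [lt|lt] := leP l t => //=; rewrite a0 ?if_same//; lra.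
Qed.

Lemma continuous_prim a : causal a -> continuous (prim a).
Proof.
move=> ca x.
pose l : R := - (`|x| + 1); pose u : R := `|x| + 1.
have x0 := normr_ge0 x.
have lu : l < u by rewrite /l /u; lra.
rewrite (_ : prim a = fun y => \int[mu]_(t in `[l, y]) a t); last first.
  by apply/funext => y; apply: prim_itv => //; rewrite /l; lra.
have i_lu : mu.-integrable `[l, u] (EFin \o a).
  case: ca => _ _ /(_ u); apply: integrableS => //.
  by move=> y/=; rewrite !in_itv/= => /andP[].
have /(continuous_within_itvP _ lu)[+ _ _] :=
  parameterized_integral_continuous (ltW lu) i_lu.
apply; rewrite in_itv/= /l /u; have := ler_norm x; have := ler_norm (- x).
by rewrite normrN => h1 h2; apply/andP; split; lra.
Qed.

Lemma derivable_prim a x : causal a -> {for x, continuous a} ->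
  derivable (prim a) x 1 /\ derive1 (prim a) x = a x.
Proof.
move=> [_ _ ia] cx.
by apply: (continuous_FTC1 _ (ia (x + 1)) (ltNyr _) cx); rewrite ltrDl.
Qed.

Lemma le_prim a x y : causal a -> (forall t, 0 <= a t) -> x <= y ->
  prim a x <= prim a y.
Proof.
move=> ca a0 xy; rewrite /prim Rintegral_mkcond [leRHS]Rintegral_mkcond.
apply: le_Rintegral => //.
- exact: integrable_upto.
- exact: integrable_upto.
- move=> t _; rewrite !patchE !mem_setE !in_itv/=.
  by case: ifPn => tx; case: ifPn => //; lra.
Qed.

Lemma causal_prim a : causal a -> causal (prim a).
Proof.
move=> ca; split.
- by apply: continuous_measurable_fun; exact: continuous_prim.
- by move=> x; exact: prim_le0.
- move=> x.
  have x0 := normr_ge0 x; have xx := ler_norm x.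
  have h : mu.-integrable `[- 1, `|x|] (EFin \o prim a).
    apply: continuous_compact_integrable; first exact: segment_compact.
    by apply: continuous_subspaceT; exact: continuous_prim.
  have {}h := (@integrable_mkcond _ _ _ mu _ (EFin \o prim a)
    (measurable_itv `[- 1, `|x|])).1 h.
  have {}h : mu.-integrable `]-oo, x] ((EFin \o prim a) \_ `[- 1, `|x|]).
    by apply: integrableS h.
  apply: eq_integrable h => // t; rewrite inE/= in_itv/= => tx.
  rewrite patchE mem_setE in_itv/=; have [t1|t1] := leP (-1) t => /=.
    by rewrite ifT//; lra.
  by rewrite prim_le0//; lra.
Qed.

Lemma prim_upto a x y : x <= y -> prim (upto x a) y = prim a x.
Proof.
move=> xy; rewrite /prim Rintegral_mkcond [RHS]Rintegral_mkcond.
apply: eq_Rintegral => s _; rewrite !patchE !mem_setE !in_itv/= uptoE.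
have [sx|sx] := boolP (s <= x); last by rewrite if_same.
by rewrite (le_trans sx xy).
Qed.

Lemma causal_upto x a : causal a -> causal (upto x a).
Proof.
move=> ca; have [ma a0 ia] := ca; split.
- by apply/measurable_EFinP; exact: (measurable_int _ (integrable_upto x ca)).
- by move=> t t0; rewrite uptoE a0// if_same.
- by move=> t; apply: integrableS (integrable_upto x ca).
Qed.

Lemma causal_norm a : causal a -> causal (fun x => `|a x|).
Proof.
move=> [ma a0 ia]; split; first exact: measurableT_comp.
- by move=> x x0; rewrite a0// normr0.
- by move=> x; apply: integrable_norm.
Qed.

Lemma locally_integrable_causal a : causal a -> locally_integrable setT a.
Proof.
move=> [ma _ ia]; split=> //; first exact: openT.
move=> K _ cK; have [M [_ KM]] := compact_bounded cK.
have {}KM : K `<=` `]-oo, (`|M| + 1)].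
  move=> z /(KM (`|M| + 1) _) h; rewrite /= in_itv/=.
  apply: (le_trans (ler_norm z)); apply: h.
  by rewrite (le_lt_trans (ler_norm M))// ltrDl.
have /integrableP[_] : mu.-integrable K (EFin \o a).
  by apply: integrableS (ia (`|M| + 1)) => //; exact: compact_measurable.
by [].
Qed.

Let derive_near0 (f : R -> R) T x : (forall y, 0 < y < T -> f y = 0) ->
  0 < x < T -> derive1 f x = 0.
Proof.
move=> f0 /andP[x0 xT]; rewrite derive1E (@near_eq_derive _ _ _ f (cst 0)).
  exact: derive_cst.
near=> y; apply: f0; apply/andP; split; near: y.
- exact: lt_nbhsr.
- exact: lt_nbhsl.
Unshelve. all: by end_near. Qed.

(** Lebesgue differentiation: at almost every point [e] is the derivative of [prim e], which is
    constant on (0, T). *)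
Lemma prim_eq0_ae e T : causal e -> (forall x, 0 < x < T -> prim e x = 0) ->
  {ae mu, forall x, 0 < x < T -> e x = 0}.
Proof.
move=> ce e0; have [_ _ ie] := ce.
have := FTC1Ny ie (locally_integrable_causal ce).
apply: filterS; first exact: (ae_filter_ringOfSetsType mu).
move=> x [_ <-] xT; exact: (derive_near0 e0 xT).
Qed.

Lemma prim_eq0_continuous e T : causal e -> continuous e ->
  (forall x, 0 < x < T -> prim e x = 0) -> forall x, 0 < x < T -> e x = 0.
Proof.
move=> ce cte e0 x xT; have [_ <-] := derivable_prim ce (cte x).
exact: (derive_near0 e0 xT).
Qed.

Lemma conv_itv a w t : causal a -> causal w ->
  conv a w t = \int[mu]_(s in `]-oo, t]) (a (t - s) * w s).
Proof.
move=> [_ a0 _] _; rewrite [RHS]Rintegral_mkcond /conv; apply: eq_Rintegral => s _.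
rewrite patchE mem_setE in_itv/=; case: ifPn => // st.
by rewrite a0 ?mul0r//; lra.
Qed.

Lemma integrable_conv_bounded p w M t : measurable_fun setT p ->
  (forall x, x <= t -> `|p x| <= M) -> causal w ->
  mu.-integrable `]-oo, t] (EFin \o (fun s => p (t - s) * w s)).
Proof.
move=> mp pM cw; have [mw w0 iw] := cw.
have : mu.-integrable `]-oo, t] (fun s => M%:E * (w s)%:E)%E.
  by apply: (integrableZl _ M (iw t)); exact: mle.
apply: le_integrable => //.
  apply/measurable_EFinP; apply: measurable_funTS; apply: measurable_funM => //.
  by apply: (measurableT_comp mp); exact: measurable_funB.
move=> s _ /=; rewrite lee_fin !normrM.
have [s0|s0] := leP s 0; first by rewrite w0// normr0 !mulr0.
by rewrite ler_wpM2r// (le_trans _ (ler_norm M))// pM//; lra.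
Qed.

End causal_theory.

(** * From the weak Caputo equation to a pointwise convolution identity *)

Section caputo_identity.
Context {R : realType}.
Local Notation mu := (@lebesgue_measure R).
Implicit Types (a w e k j nu : R -> R) (b c r t s x T : R).

Let mle {x} : measurable (`]-oo, x]%classic : set R).
Proof. exact: measurable_itv. Qed.

(** The primitive of [e] vanishes on (0, T) and, by continuity, has derivative [e] at every point
    there. *)
Lemma ae_eq0_continuous e T : causal e -> continuous e ->
  {ae mu, forall x, 0 < x < T -> e x = 0} -> forall x, 0 < x < T -> e x = 0.
Proof.
move=> ce cte e0; apply: (prim_eq0_continuous ce cte) => x /andP[x0 xT].
have [me e0' _] := ce.
rewrite /prim /Rintegral (@ae_eq_integral _ _ _ _ _ (cst 0%E)) ?integral0//.
  by apply/measurable_EFinP; exact: measurable_funTS.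
move: e0; apply: filterS; first exact: (ae_filter_ringOfSetsType mu).
move=> t et /=; rewrite in_itv/= => tx; congr EFin.
by have [t0|t0] := leP t 0; [exact: e0'|apply: et; rewrite t0/=; lra].
Qed.

Lemma derive_reflect (f : R -> R) b r : derivable f (b - r) 1 ->
  derivable (fun x => f (b - x)) r 1 /\
  derive1 (fun x => f (b - x)) r = - derive1 f (b - r).
Proof.
move=> /derivableP df.
have db : is_derive r 1 (fun x : R => b - x) (- 1).
  by apply: is_derive_eq; rewrite add0r mul1r.
have := @is_derive1_comp _ f _ r _ _ df db.
rewrite mulrN1 -derive1E => fb; split; first exact: ex_derive.
by rewrite derive1E; exact: derive_val.
Qed.

(** The Caputo derivative is tested against [t |-> (1 * 1 * j)(b - t)]: two
    integrations make the kernel [j], unbounded at 0, of class C^1. *)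
Lemma test_function_prim j b T : causal j -> b <= T ->
  test_function T (fun t => prim (prim j) (b - t)).
Proof.
move=> cj bT; have cp := causal_prim cj; have ct := continuous_prim cj.
have dp x := derivable_prim cp (ct x).
split=> [t||].
- exact: (derive_reflect (dp (b - t)).1).1.
- rewrite (_ : derive1 _ = fun t => - prim j (b - t)); last first.
    apply/funext => t; rewrite (derive_reflect (dp (b - t)).1).2.
    by rewrite (dp (b - t)).2.
  move=> t; apply: cvgN; apply: (@cvg_comp _ _ _ (fun x => b - x) (prim j)).
    by apply: cvgB; [exact: cvg_cst|exact: cvg_id].
  exact: ct.
- by rewrite prim_le0//; lra.
Qed.

Lemma Rintegral_reflect c (f : R -> R) : measurable_fun setT f ->
  \int[mu]_x f x = \int[mu]_x f (c - x).
Proof.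
move=> mf; congr fine; rewrite (integral_reflect c)//; exact/measurable_EFinP.
Qed.

(** The reflection [t -> b - t] turns the right-sided integral of the test function into an ordinary
    convolution, and [prim] can be moved from one factor to the product. The upper limit [T]
    disappears because the test function is 0 beyond [b]. *)
Lemma right_conv_prim k j b T r : causal k -> causal j -> b <= T ->
  \int[mu]_(t in `]r, T[) (k (t - r) * prim (prim j) (b - t)) =
  prim (prim (conv k j)) (b - r).
Proof.
move=> ck cj bT.
have cpj := causal_prim cj; have cppj := causal_prim cpj.
have [mk k0 _] := ck; have [mj _ _] := cj; have [mppj _ _] := cppj.
have -> : prim (prim (conv k j)) = conv k (prim (prim j)).
  by rewrite (convC mk mj) prim_conv// prim_conv// convC.
transitivity (\int[mu]_t (k (t - r) * prim (prim j) (b - t))).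
  rewrite Rintegral_mkcond; apply: eq_Rintegral => t _.
  rewrite patchE mem_setE in_itv/=.
  have [tr|tr] /= := ltP r t; last by rewrite k0 ?mul0r//; lra.
  by have [//|tT] := ltP t T; rewrite (@prim_le0 _ (prim j)) ?mulr0//; lra.
rewrite (Rintegral_reflect b); last first.
  apply: measurable_funM.
    by apply: (measurableT_comp mk); exact: measurable_funB.
  by apply: (measurableT_comp mppj); exact: measurable_funB.
rewrite /conv; apply: eq_Rintegral => s _.
by congr (k _ * prim (prim j) _); lra.
Qed.

Section weak_form.
Variables (k j nu : R -> R) (kappa0 T : R).
Hypotheses (ck : causal k) (cj : causal j) (cnu : causal nu).
Hypothesis kappaE : forall t, 0 < t -> conv k j t = kappa0 - prim nu t.

Let ckj : causal (conv k j). Proof. exact: causal_conv. Qed.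

Lemma conv_split g t : causal g ->
  conv (conv k j) g t = kappa0 * prim g t - prim (conv nu g) t.
Proof.
move=> cg; rewrite prim_conv//.
have cpnu := causal_prim cnu; have [_ _ ig] := cg.
have it : mu.-integrable `]-oo, t] (EFin \o (fun s => prim nu (t - s) * g s)).
  apply: (@integrable_conv_bounded _ _ _ (prim (fun s => `|nu s|) t)) => //.
    by case: cpnu.
  move=> x xt; have [_ _ inu] := cnu.
  apply: (@le_trans _ _ (prim (fun s => `|nu s|) x)).
    exact: (le_normr_Rintegral _ (inu x)).
  by apply: le_prim => //; exact: causal_norm.
have igt : mu.-integrable `]-oo, t[ (EFin \o g).
  apply: integrableS (ig t) => //.
  by move=> x /=; rewrite !in_itv/=; exact: ltW.
have iprim : mu.-integrable `]-oo, t[ (EFin \o (fun s => prim nu (t - s) * g s)).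
  by apply: integrableS it => // x /=; rewrite !in_itv/=; exact: ltW.
(* [kappaE] holds for positive arguments only: at [s = t] causality makes [conv k j] equal to 0 and
   not [kappa0], so the interval is taken open. *)
transitivity (\int[mu]_(s in `]-oo, t[) (kappa0 * g s - prim nu (t - s) * g s)).
  have := kappaE; case: ckj; set K := conv k j => _ K0 _ KE.
  rewrite /conv [RHS]Rintegral_mkcond; apply: eq_Rintegral => s _.
  rewrite patchE mem_setE in_itv/=; have [st|st] := ltP s t.
    by rewrite -mulrBl -KE// subr_gt0.
  by rewrite K0 ?mul0r//; lra.
rewrite RintegralB//; last by apply: (integrableZl _ kappa0 igt).
rewrite RintegralZl// Rintegral_itv_bndo_bndc//; congr (_ - _).
rewrite /conv Rintegral_mkcond; apply: eq_Rintegral => s _.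
rewrite patchE mem_setE in_itv/=; have [//|st] := ltP s t.
by rewrite prim_le0 ?mul0r//; lra.
Qed.

Variables (W g : R -> R).
Hypotheses (cW : causal W) (cg : causal g).
Hypotheses (W0 : forall t, T <= t -> W t = 0) (g0 : forall t, T <= t -> g t = 0).
Hypothesis caputoWg : forall phi, test_function T phi ->
  \int[mu]_(t in `]0, T[) (W t * phi t) =
  - \int[mu]_(t in `]0, T[)
     (g t * derive1 (fun r => \int[mu]_(t in `]r, T[) (k (t - r) * phi t)) t).

(** This is the Caputo equation tested with [prim (prim j) (b - t)]. Letting [b] vary makes it an
    identity of functions, which can be differentiated in [b]. *)
Let conv_eq b : b <= T -> conv (prim (prim j)) W b = conv (prim (conv k j)) g b.
Proof.
move=> bT; have cpkj := causal_prim ckj; have ct := continuous_prim ckj.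
have itvT (p q : R -> R) : causal q -> (forall t, T <= t -> q t = 0) ->
    \int[mu]_(t in `]0, T[) (q t * p (b - t)) = conv p q b.
  move=> [_ q0 _] qT; rewrite /conv Rintegral_mkcond; apply: eq_Rintegral => t _.
  rewrite patchE mem_setE in_itv/=; have [t0|t0] /= := ltP 0 t; last first.
    by rewrite q0// mulr0.
  by have [tT|tT] := ltP t T; [rewrite mulrC|rewrite qT// mulr0].
have := caputoWg (test_function_prim cj bT).
rewrite (_ : (fun r => \int[mu]_(t in `]r, T[) (k (t - r) * prim (prim j) (b - t)))
    = (fun r => prim (prim (conv k j)) (b - r))); last first.
  by apply/funext => r'; exact: right_conv_prim.
under [X in _ = - X -> _]eq_Rintegral => r _.
  have [h1 h2] := derivable_prim cpkj (ct (b - r)).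
  rewrite (derive_reflect h1).2 h2 mulrN.
  over.
by rewrite RintegralN opprK !itvT.
Qed.

(** The two integrations in the test function are undone in turn. The first differentiation gives an
    identity almost everywhere; with [conv_split] its two sides are primitives, hence continuous, so
    it holds on all of (0, T) and can be differentiated again. *)
Lemma caputo_conv : {ae mu, forall t, 0 < t < T ->
  conv j W t = kappa0 * g t - conv nu g t}.
Proof.
have cpj := causal_prim cj; have cnug := causal_conv cnu cg.
have cjW := causal_conv cj cW; have ckjg := causal_conv ckj cg.
have cpjW := causal_conv cpj cW.
have E0 : {ae mu, forall t, 0 < t < T ->
    conv (prim j) W t - conv (conv k j) g t = 0}.
  apply: prim_eq0_ae (causalB cpjW ckjg) _ => b /andP[_ bT].
  rewrite primB// (prim_conv ckj cg) (prim_conv cpj cW) conv_eq ?subrr//.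
  exact: ltW.
pose e t := conv j W t - (kappa0 * g t - conv nu g t).
have cs : causal (fun t => kappa0 * g t - conv nu g t).
  by apply: causalB => //; exact: causalZ.
have ce : causal e by exact: causalB.
have pe0 : forall t, 0 < t < T -> prim e t = 0.
  apply: ae_eq0_continuous; [exact: causal_prim|exact: continuous_prim|].
  move: E0; apply: filterS; first exact: (ae_filter_ringOfSetsType mu).
  move=> t Et tT; rewrite primB// primB//; last exact: causalZ.
  by rewrite primZ// -conv_split// prim_conv// Et.
have := prim_eq0_ae ce pe0; apply: filterS.
  exact: (ae_filter_ringOfSetsType mu).
by move=> t et tT; apply/eqP; rewrite -subr_eq0; apply/eqP/et.
Qed.

End weak_form.

End caputo_identity.

(** * Powers on the positive half-line and their integrability at 0 *)

Section power_kernel.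
Context {R : realType}.
Local Notation mu := (@lebesgue_measure R).
Implicit Types (p x y t : R).

(** [powR] does not vanish on the negative half-line; the cut makes the power causal. In particular
    [pow 0] is the indicator of the positive reals. *)
Definition pow p t : R := if 0 < t then t `^ p else 0.

Lemma pow_ge0 p t : 0 <= pow p t.
Proof. by rewrite /pow; case: ifP => // _; exact: powR_ge0. Qed.

Lemma measurable_pow p : measurable_fun setT (pow p).
Proof.
apply: measurable_fun_ifT => //.
exact: measurable_fun_ltr.
Qed.

Let integral_powR_itv p x y : -1 < p -> 0 < x -> x < y ->
  (\int[mu]_(t in `[x, y]) (t `^ p)%:E =
   (y `^ (p + 1) / (p + 1) - x `^ (p + 1) / (p + 1))%:E)%E.
Proof.
move=> p1 x0 xy; have p10 : p + 1 != 0 by rewrite gt_eqF//; lra.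
have dF t : 0 < t -> is_derive t 1 (fun z => z `^ (p + 1) / (p + 1)) (t `^ p).
  move=> t0; have := is_derive1_powR (p + 1) t0; rewrite addrK => h.
  apply: is_derive_eq.
  by rewrite !scaler0 add0r /GRing.scale/= mulrA mulVf// mul1r.
have cF t : 0 < t -> {for t, continuous (fun z => z `^ (p + 1) / (p + 1))}.
  move=> t0; apply/differentiable_continuous/derivable1_diffP.
  by have [] := dF _ t0.
rewrite (@continuous_FTC2 _ _ (fun z => z `^ (p + 1) / (p + 1)))//.
- apply: continuous_in_subspaceT => t; rewrite inE/= in_itv/= => /andP[xt _].
  apply/differentiable_continuous/derivable1_diffP; apply: derivable_powR.
  by rewrite in_itv/= andbT; lra.
- split.
  + move=> t; rewrite in_itv/= => /andP[xt _].
    by apply: (@ex_derive _ _ _ _ _ _ _ (dF t _)); lra.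
  + by apply: cvg_at_right_filter; exact: cF.
  + by apply: cvg_at_left_filter; apply: cF; lra.
- move=> t; rewrite in_itv/= => /andP[xt _].
  by rewrite derive1E; apply: (@derive_val _ _ _ _ _ _ _ (dF t _)); lra.
Qed.

Lemma causal_pow p : -1 < p -> causal (pow p).
Proof.
move=> p1; split; first exact: measurable_pow.
  by move=> x x0; rewrite /pow ltNge x0.
move=> x0; pose x := Num.max x0 1.
have x_gt0 : 0 < x by rewrite lt_max ltr01 orbT.
suff : mu.-integrable `]-oo, x] (EFin \o pow p).
  apply: integrableS => //; apply: subset_itvl; rewrite bnd_simp.
  by rewrite le_max lexx.
apply/integrableP; split.
  by apply/measurable_EFinP; apply: measurable_funTS; exact: measurable_pow.
(* Away from 0 the fundamental theorem of calculus bounds the integral by [x^(p + 1) / (p + 1)],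
   uniformly in [n]; [n.+2] ensures [x / n.+2 < x]. *)
pose F (n : nat) : set R := `[x / n.+2%:R, x]%classic.
have x0n n : 0 < x / n.+2%:R by rewrite divr_gt0.
have xnx n : x / n.+2%:R < x by rewrite ltr_pdivrMr// ltr_pMr// ltr1n.
have UF : \bigcup_n F n = `]0, x]%classic.
  apply/seteqP; split => [t [n _]|t]; rewrite /F/= !in_itv/=.
    by move=> /andP[h ->]; rewrite andbT; exact: lt_le_trans h.
  move=> /andP[t0 tx]; exists (Num.truncn (x / t)) => //=; rewrite in_itv/= tx andbT.
  rewrite ler_pdivrMr// -ler_pdivrMl// mulrC.
  apply: ltW; apply: lt_trans (truncnS_gt _) _.
  by rewrite ltr_nat.
have mF n : measurable (F n) by exact: measurable_itv.
rewrite (_ : integral _ _ _ = \int[mu]_(t in `]0%R, x]) (t `^ p)%:E)%E; last first.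
  rewrite integral_mkcond [RHS]integral_mkcond; apply: eq_integral => t _.
  rewrite !patchE !mem_setE !in_itv/= /pow; have [t0|t0] /= := ltP 0 t.
    by rewrite ger0_norm// powR_ge0.
  by rewrite normr0 if_same.
rewrite -UF.
have mp n : measurable_fun (F n) (fun t => (t `^ p)%:E).
  by apply/measurable_EFinP; apply: measurable_funTS; exact: measurable_powR.
have ndF : nondecreasing_seq F.
  apply/nondecreasing_seqP => n; rewrite subsetEset; apply: subset_itvr.
  by rewrite bnd_simp ler_pM2l// lef_pV2 ?posrE// ler_nat.
have h := @ge0_nondecreasing_set_cvg_integral _ (measurableTypeR R) _ F _ mu ndF mF mp.
have {}h := h (fun i x _ => powR_ge0 x p).
rewrite -(cvg_lim _ h)//.
apply: (@le_lt_trans _ _ (x `^ (p + 1) / (p + 1))%:E); last exact: ltry.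
apply: lime_le; first by apply/cvg_ex; eexists; exact: h.
apply: nearW => n; rewrite integral_powR_itv// lee_fin lerBlDr lerDl.
by apply: divr_ge0; [exact: powR_ge0|lra].
Qed.

End power_kernel.

(** * The exponentially damped kernels and their convolution with k *)

Section yosida_kernels.
Context {R : realType}.
Local Notation mu := (@lebesgue_measure R).
Implicit Types (p x y t s l d : R).

Lemma pow_decr p s t : p <= 0 -> 0 < s -> s <= t -> pow p t <= pow p s.
Proof.
move=> p0 s0 st; rewrite /pow s0 (lt_le_trans s0 st).
have t0 := lt_le_trans s0 st.
rewrite -(opprK p) powRN [leRHS]powRN lef_pV2 ?posrE ?powR_gt0//.
by apply: ge0_ler_powR; rewrite ?nnegrE; lra.
Qed.

Lemma powM p s t : 0 < t -> pow p (t * s) = t `^ p * pow p s.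
Proof.
move=> t0; rewrite /pow pmulr_rgt0//; case: ifPn => s0; last by rewrite mulr0.
by rewrite powRM// ltW.
Qed.

Variables (gamma c T : R).
Hypotheses (gamma_gt0 : 0 < gamma) (gamma_lt1 : gamma < 1) (c0 : 0 <= c).
Hypothesis (T_gt0 : 0 < T).

Let cpow1 : causal (pow (gamma - 1)).
Proof. by apply: causal_pow; have := gamma_gt0; have := gamma_lt1; lra. Qed.

Let cpowN : causal (pow (- gamma)).
Proof. by apply: causal_pow; have := gamma_gt0; have := gamma_lt1; lra. Qed.

Let q l t := pow (gamma - 1) t * expR (- (l * t)).

Let q_ge0 l t : 0 <= q l t.
Proof. by rewrite /q mulr_ge0 ?pow_ge0 ?expR_ge0. Qed.

Let measurable_expRl l : measurable_fun setT (fun t : R => expR (- (l * t))).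
Proof.
apply: measurableT_comp => //; apply: measurableT_comp => //.
Qed.

Let causal_q l : 0 <= l -> causal (q l).
Proof.
move=> l0; have [mp p0 ip] := cpow1.
have mq : measurable_fun setT (q l) by exact: measurable_funM.
split=> //.
- by move=> x x0; rewrite /q p0 ?mul0r.
- move=> x; apply: le_integrable (ip x) => //.
    by apply/measurable_EFinP; exact: measurable_funTS.
  move=> t _ /=; rewrite lee_fin ger0_norm// ger0_norm ?pow_ge0//.
  have [t0|t0] := leP t 0; first by rewrite /q p0// mul0r.
  by rewrite ler_piMr ?pow_ge0// expR_le1 oppr_le0 mulr_ge0// ltW.
Qed.

(** [q l] decreases on the positive half-line, so on []0, d]] it is at least its value at [d]. *)
Let prim_q_ge l d : 0 <= l -> 0 < d ->
  d * (pow (gamma - 1) d * expR (- (l * d))) <= prim (q l) d.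
Proof.
move=> l0 d0; set m := pow _ _ * _.
have m0 : 0 <= m by exact: q_ge0.
have md : measurable (`]0, d]%classic : set R) by exact: measurable_itv.
have mud : mu `]0, d]%classic = d%:E.
  by rewrite lebesgue_measure_itv/= lte_fin d0 -EFinB subr0.
have -> : d * m = \int[mu]_(t in `]0, d]) m.
  by rewrite Rintegral_cst// mulrC; congr (_ * _); exact: esym (congr1 fine mud).
have [mq q0 iq] := causal_q l0.
rewrite /prim Rintegral_mkcond [leRHS]Rintegral_mkcond.
apply: le_Rintegral => //.
- rewrite -restrict_EFin.
  apply: (@integrable_mkcond _ _ _ mu _ (cst m%:E) md).1.
  apply: (@measurable_bounded_integrable _ _ _ mu (cst m) _ md) => //.
    by rewrite [X in (X < _)%E]mud ltry.
  exact: bounded_cst.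
- exact: integrable_upto.
- move=> t _; rewrite !patchE !mem_setE !in_itv/=.
  have [t0 /=|t0 /=] := ltP 0 t; last by case: ifP.
  case: ifP => // td; rewrite ler_pM ?pow_ge0 ?expR_ge0//.
    by apply: pow_decr => //; rewrite subr_le0 ltW.
  by rewrite ler_expR lerN2 ler_wpM2l.
Qed.

Let prim_q_gt0 l d : 0 <= l -> 0 < d -> 0 < prim (q l) d.
Proof.
move=> l0 d0; apply: lt_le_trans (prim_q_ge l0 d0).
by rewrite !mulr_gt0 ?expR_gt0// /pow d0 powR_gt0.
Qed.

Let prim_q_tail l t : 0 <= l -> 0 < t -> t <= T ->
  prim (q l) T - prim (q l) t <= expR (- (l * t)) * prim (pow (gamma - 1)) T.
Proof.
move=> l0 t0 tT; rewrite lerBlDr.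
have cq := causal_q l0; have [_ _ iq] := cq.
have -> : prim (q l) t = prim (upto t (q l)) T.
  rewrite /prim Rintegral_mkcond [RHS]Rintegral_mkcond.
  apply: eq_Rintegral => s _; rewrite !patchE !mem_setE !in_itv/=.
  rewrite uptoE; case: ifPn => st; last by rewrite if_same.
  by rewrite (le_trans st tT).
have iut : mu.-integrable `]-oo, T] (EFin \o upto t (q l)).
  have := integrable_upto t cq; apply: integrableS => //.
have [_ _ ip] := cpow1.
have iep : mu.-integrable `]-oo, T]
    (EFin \o (fun s => expR (- (l * t)) * pow (gamma - 1) s)).
  by apply: (integrableZl _ _ (ip T)).
rewrite -primZ// /prim -RintegralD//.
apply: le_Rintegral => //.
  by apply: (integrableD _ iep iut).
move=> s _; rewrite uptoE; case: ifPn => st.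
  by rewrite lerDr mulr_ge0 ?expR_ge0 ?pow_ge0.
rewrite addr0 /q mulrC ler_wpM2r ?pow_ge0// ler_expR lerN2 ler_wpM2l//.
by rewrite ltW// ltNge.
Qed.

Let k t := c * pow (- gamma) t.
Let j l t := (prim (q l) T)^-1 * q l t.

Let cvg_prim_j t : 0 < t -> t <= T -> prim (j n%:R) t @[n --> \oo] --> (1 : R).
Proof.
move=> t0 tT.
have t20 : 0 < t / 2 by lra.
pose P := prim (pow (gamma - 1)) T.
pose m := t / 2 * pow (gamma - 1) (t / 2).
have m0 : 0 < m by rewrite mulr_gt0// /pow t20 powR_gt0.
have P0 : 0 <= P by apply: prim_ge0 => s; exact: pow_ge0.
(* The mass of [q n] beyond [t] is at most [P * exp(- n t)], while its mass up to [t / 2] is at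
   least [m * exp(- n t / 2)]; the ratio decays geometrically. *)
have lb n : 1 - P / m * (expR (- (t / 2))) ^+ n <= prim (j n%:R) t.
  have n0 : 0 <= n%:R :> R by [].
  have cn := prim_q_gt0 n0 T_gt0.
  rewrite /j (primZ _ _ (causal_q n0)) -expRM_natl.
  have h1 := prim_q_tail n0 t0 tT.
  have h2 := prim_q_ge n0 t20.
  have h3 : prim (q n%:R) (t / 2) <= prim (q n%:R) T.
    by apply: le_prim => //; [exact: causal_q|lra].
  rewrite [leRHS]mulrC ler_pdivlMr// mulrBl mul1r lerBlDl -lerBlDr.
  apply: (le_trans h1).
  rewrite -/P (_ : expR (- (n%:R * t)) =
    expR (n%:R * - (t / 2)) * expR (- (n%:R * (t / 2)))); last first.
    by rewrite -expRD; congr expR; lra.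
  set e := expR (n%:R * _).
  have e0 : 0 <= e by exact: expR_ge0.
  rewrite (_ : _ * P = P * e * expR (- (n%:R * (t / 2)))); last by ring.
  rewrite (_ : P / m * e * _ = P * e * (prim (q n%:R) T / m)); last by ring.
  rewrite ler_wpM2l// ?mulr_ge0// ler_pdivlMr// (le_trans _ h3)//.
  by apply: le_trans h2; rewrite le_eqVlt; apply/orP; left; apply/eqP; rewrite /m; ring.
have ub n : prim (j n%:R) t <= 1.
  have n0 : 0 <= n%:R :> R by [].
  have cn := prim_q_gt0 n0 T_gt0.
  rewrite /j (primZ _ _ (causal_q n0)) mulrC ler_pdivrMr// mul1r.
  by apply: le_prim => //; exact: causal_q.
apply: (@squeeze_cvgr _ _ _ _ (fun n => 1 - P / m * (expR (- (t / 2))) ^+ n)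
  (cst 1)).
- by apply: nearW => n; rewrite lb ub.
- rewrite -[X in _ --> X]subr0; apply: cvgB; first exact: cvg_cst.
  rewrite -(mulr0 (P / m)); apply: cvgM; first exact: cvg_cst.
  apply: cvg_expr; rewrite ger0_norm ?expR_ge0//.
  by rewrite expR_lt1; lra.
- exact: cvg_cst.
Qed.

(** The integrand of the Euler integral B(1 - gamma, gamma). *)
Let beta s := pow (- gamma) (1 - s) * pow (gamma - 1) s.

Let beta_ge0 s : 0 <= beta s.
Proof. by rewrite mulr_ge0 ?pow_ge0. Qed.

Let beta_eq0 s : s <= 0 \/ 1 <= s -> beta s = 0.
Proof.
rewrite /beta => -[s0|s1].
  by case: cpow1 => _ -> //; rewrite mulr0.
by case: cpowN => _ -> //; rewrite ?mul0r// subr_le0.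
Qed.

Let measurable_beta : measurable_fun setT beta.
Proof.
apply: measurable_funM; last exact: measurable_pow.
by apply: (measurableT_comp (@measurable_pow _ _)); exact: measurable_funB.
Qed.

Let integrable_beta : mu.-integrable setT (EFin \o beta).
Proof.
(* Each half of (0, 1) contains one singularity, and there the other factor is at most its value at
   1/2. *)
have i1 := integrableZl measurableT (2^-1 `^ (- gamma)) (integrable_upto 1 cpow1).
have i2 := integrableZl measurableT (2^-1 `^ (gamma - 1))
  (integrable_reflect 1 (integrable_upto 1 cpowN)).
apply: le_integrable (integrableD measurableT i1 i2) => //.
  exact/measurable_EFinP.
move=> s _ /=; rewrite lee_fin ger0_norm ?beta_ge0//.
apply: le_trans (ler_norm _).
have half : 0 < 2^-1 :> R by [].
have powh p : pow p 2^-1 = 2^-1 `^ p by rewrite /pow half.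
have g0 := gamma_gt0; have g1 := gamma_lt1.
have p1 := pow_ge0; have p2 := @powR_ge0 R.
have u1 z p : 0 <= upto 1 (pow p) z by rewrite uptoE; case: ifP.
have [s0|s0] := leP s 0.
  by rewrite beta_eq0 ?addr_ge0 ?mulr_ge0//; left.
have [s1|s1] := leP 1 s.
  by rewrite beta_eq0 ?addr_ge0 ?mulr_ge0//; right.
have [sh|sh] := leP s 2^-1.
  apply: (@le_trans _ _ (2^-1 `^ (- gamma) * upto 1 (pow (gamma - 1)) s)).
    rewrite uptoE (ltW s1) /beta ler_wpM2r ?pow_ge0//.
    by rewrite -powh; apply: pow_decr => //; lra.
  by rewrite lerDl mulr_ge0.
apply: (@le_trans _ _ (2^-1 `^ (gamma - 1) * upto 1 (pow (- gamma)) (1 - s))).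
  rewrite uptoE ifT; last by lra.
  rewrite /beta mulrC ler_wpM2r ?pow_ge0//.
  by rewrite -powh; apply: pow_decr => //; lra.
by rewrite lerDr mulr_ge0.
Qed.

Let C l := c / prim (q l) T.

Let integrable_beta_expR l t : 0 <= l -> 0 <= t ->
  mu.-integrable setT (EFin \o (fun s => beta s * expR (- (l * t * s)))).
Proof.
move=> l0 t0.
apply: le_integrable integrable_beta => //.
  apply/measurable_EFinP.
  exact: (measurable_funM measurable_beta (measurable_expRl _)).
move=> s _ /=; rewrite lee_fin (ger0_norm (beta_ge0 s)).
rewrite (ger0_norm (mulr_ge0 (beta_ge0 s) (expR_ge0 _))).
have [s0|s0] := leP s 0; first by rewrite beta_eq0 ?mul0r//; left.
by rewrite ler_piMr ?beta_ge0// expR_le1 oppr_le0 !mulr_ge0// ltW.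
Qed.

(** Substituting [t * s] for [s] produces the factor [t * t^(- gamma) * t^(gamma - 1) = 1], so [t]
    survives only in the exponential. *)
Let integral_kj l t : 0 <= l -> 0 < t ->
  (\int[mu]_s (k (t - s) * j l s)%:E =
   \int[mu]_s (C l * (beta s * expR (- (l * t * s))))%:E)%E.
Proof.
move=> l0 t0.
have tE : t * (t `^ (- gamma) * t `^ (gamma - 1)) = 1.
  rewrite -powRD; last by rewrite (gt_eqF t0) implybT.
  rewrite (_ : - gamma + (gamma - 1) = - 1); last by ring.
  by rewrite powR_inv1 ?(ltW t0)// mulfV// gt_eqF.
have mkj : measurable_fun setT (fun s => k (t - s) * j l s).
  apply: measurable_funM.
    apply: measurable_funM => //.
    by apply: (measurableT_comp (@measurable_pow _ _)); exact: measurable_funB.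
  apply: measurable_funM => //; apply: measurable_funM => //.
  exact: measurable_pow.
rewrite (@ge0_integral_affine _ t 0) ?gt_eqF//; last 2 first.
- exact/measurable_EFinP.
- move=> s; rewrite lee_fin !mulr_ge0 ?pow_ge0 ?expR_ge0// invr_ge0.
  exact/ltW/prim_q_gt0.
rewrite gtr0_norm// -ge0_integralZl//; last 2 first.
- move=> s _; rewrite lee_fin !mulr_ge0 ?pow_ge0 ?expR_ge0// invr_ge0.
  exact/ltW/prim_q_gt0.
- by rewrite lee_fin ltW.
apply: eq_integral => s _; rewrite -EFinM; congr EFin.
rewrite addr0 /k /j /q (_ : t - t * s = t * (1 - s)); last by ring.
rewrite !powM// /C /beta (_ : l * (t * s) = l * t * s); last by ring.
by set A := RHS; transitivity (t * (t `^ (- gamma) * t `^ (gamma - 1)) * A);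
  [rewrite /A; ring|rewrite tE mul1r].
by apply/measurable_EFinP; exact: (measurableT_comp mkj (measurable_affine t 0)).
Qed.

Let conv_kj l t : 0 <= l -> 0 < t ->
  conv k (j l) t = C l * \int[mu]_s (beta s * expR (- (l * t * s))).
Proof.
move=> l0 t0; have ie := integrable_beta_expR l0 (ltW t0).
rewrite -(@RintegralZl _ _ _ mu setT _ (C l) measurableT ie).
by congr fine; exact: integral_kj.
Qed.

Let k_ge0 t : 0 <= k t. Proof. by rewrite mulr_ge0 ?pow_ge0. Qed.

Let j_ge0 l t : 0 <= l -> 0 <= j l t.
Proof. by move=> l0; rewrite mulr_ge0// invr_ge0; exact/ltW/prim_q_gt0. Qed.

Let causal_j l : 0 <= l -> causal (j l).
Proof. by move=> l0; apply: causalZ; exact: causal_q. Qed.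

Let integrable_kj l t : 0 <= l -> 0 < t ->
  mu.-integrable setT (EFin \o (fun s => k (t - s) * j l s)).
Proof.
move=> l0 t0; apply/integrableP; split.
  apply/measurable_EFinP; apply: measurable_funM; last by have [] := causal_j l0.
  apply: measurable_funM => //.
  by apply: (measurableT_comp (@measurable_pow _ _)); exact: measurable_funB.
under eq_integral do rewrite /= (ger0_norm (mulr_ge0 (k_ge0 _) (j_ge0 _ l0))).
rewrite integral_kj//.
apply: integrable_lty => //.
exact: (integrableZl measurableT (C l) (integrable_beta_expR l0 (ltW t0))).
Qed.

Let k_prim_le l t : 0 <= l -> 0 < t -> k t * prim (j l) t <= conv k (j l) t.
Proof.
move=> l0 t0; have [_ _ ij] := causal_j l0.
have mt : measurable (`]-oo, t[%classic : set R) by exact: measurable_itv.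
have ijt : mu.-integrable `]-oo, t[ (EFin \o j l).
  by apply: integrableS (ij t) => // x /=; rewrite !in_itv/=; exact: ltW.
have ik : mu.-integrable `]-oo, t[ (EFin \o (fun s => k (t - s) * j l s)).
  exact: (@integrableS _ _ _ mu setT _ _ measurableT mt (@subsetT _ _)
    (integrable_kj l0 t0)).
rewrite (_ : conv k (j l) t = \int[mu]_(s in `]-oo, t[) (k (t - s) * j l s)).
  rewrite /prim -Rintegral_itv_bndo_bndc// -RintegralZl//.
  apply: le_Rintegral => //; first by apply: (integrableZl _ (k t) ijt).
  move=> s; rewrite /= in_itv/= => st; have [_ jz _] := causal_j l0.
  have [s0|s0] := leP s 0; first by rewrite jz// !mulr0.
  rewrite ler_wpM2r ?j_ge0// /k ler_wpM2l//.
  have g0 := gamma_gt0; apply: pow_decr; lra.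
rewrite [RHS]Rintegral_mkcond /conv; apply: eq_Rintegral => s _.
rewrite patchE mem_setE in_itv/=; have [//|st] := ltP s t.
by rewrite /k; have [_ -> //] := cpowN; rewrite ?mulr0 ?mul0r// subr_le0.
Qed.

Let B := \int[mu]_s beta s.

(** By [conv_kj], [conv k (j l) t] is C_l \int_0^1 beta(s) exp(- l t s) ds;
    [nu l] is minus the [t]-derivative of this. *)
Let nuE l t : \bar R := (\int[mu]_s (beta s * (l * s * expR (- (l * s * t))))%:E)%E.

Let nu l t := if 0 < t then C l * fine (nuE l t) else 0.

Let nuker_ge0 l s t : 0 <= l -> 0 <= beta s * (l * s * expR (- (l * s * t))).
Proof.
move=> l0; have [s0|s0] := leP s 0; first by rewrite beta_eq0 ?mul0r//; left.
by rewrite !mulr_ge0 ?expR_ge0 ?pow_ge0// ltW.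
Qed.

Let measurable_nuker l :
  measurable_fun [set: measurableTypeR R * measurableTypeR R]
    (fun z => beta z.2 * (l * z.2 * expR (- (l * z.2 * z.1)))).
Proof.
apply: measurable_funM; first exact: (measurableT_comp measurable_beta).
have m2 : measurable_fun [set: measurableTypeR R * measurableTypeR R]
    (fun z => l * z.2) by exact: measurable_funM.
apply: measurable_funM => //.
apply: measurableT_comp => //; apply: measurableT_comp => //.
exact: measurable_funM.
Qed.

Let measurable_nuE l : 0 <= l -> measurable_fun setT (nuE l).
Proof.
move=> l0.
apply: (@measurable_fun_fubini_tonelli_F _ _ _ _ _ mu
  (fun z => (beta z.2 * (l * z.2 * expR (- (l * z.2 * z.1))))%:E)).
  by apply/measurable_EFinP; exact: measurable_nuker.
by move=> z; rewrite lee_fin nuker_ge0.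
Qed.

Let measurable_nu l : 0 <= l -> measurable_fun setT (nu l).
Proof.
move=> l0; apply: measurable_fun_ifT => //; first exact: measurable_fun_ltr.
apply: measurable_funM => //; apply: measurableT_comp => //.
exact: measurable_nuE.
Qed.

Let nuE_fin l t : 0 <= l -> 0 < t -> nuE l t \is a fin_num.
Proof.
move=> l0 t0; apply: integrable_fin_num => //.
have := integrableZl measurableT l integrable_beta; apply: le_integrable => //.
  apply/measurable_EFinP; apply: measurable_funM => //.
  apply: measurable_funM => //; apply: measurableT_comp => //.
  apply: measurableT_comp => //; apply: measurable_funM => //.
move=> s _; rewrite /= lee_fin ger0_norm ?nuker_ge0//.
rewrite (ger0_norm (mulr_ge0 l0 (beta_ge0 s))) mulrC.
have [s0|s0] := leP s 0; first by rewrite beta_eq0 ?mulr0//; left.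
have [s1|s1] := leP 1 s; first by rewrite beta_eq0 ?mulr0//; right.
rewrite ler_wpM2r ?beta_ge0// -mulrA ler_piMr//.
rewrite mulr_ile1 ?expR_ge0 ?(ltW s0) ?(ltW s1)//.
by rewrite expR_le1 oppr_le0 !mulr_ge0// ltW.
Qed.

Let integral_nuker l s t : 0 <= l -> 0 < t -> 0 < s ->
  (\int[mu]_(x in `]0%R, t]) (l * s * expR (- (l * s * x)))%:E =
  (1 - expR (- (l * s * t)))%:E)%E.
Proof.
move=> l0 t0 s0; set m := l * s.
have cm : continuous (fun x : R => m * expR (- (m * x))).
  move=> x; apply: cvgM; first exact: cvg_cst.
  apply: continuous_comp; last exact: continuous_expR.
  by apply: cvgN; apply: cvgM; [exact: cvg_cst|exact: cvg_id].
have cF : continuous (fun x : R => - expR (- (m * x))).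
  move=> x; apply: cvgN.
  apply: continuous_comp; last exact: continuous_expR.
  by apply: cvgN; apply: cvgM; [exact: cvg_cst|exact: cvg_id].
have dF x : is_derive x 1 (fun x : R => - expR (- (m * x))) (m * expR (- (m * x))).
  by apply: is_derive_eq; rewrite /GRing.scale/=; ring.
rewrite integral_itv_obnd_cbnd; last first.
  by apply/measurable_EFinP; apply: measurable_funTS; exact: continuous_measurable_fun.
rewrite (@continuous_FTC2 _ _ (fun x => - expR (- (m * x))))//.
- by rewrite mulr0 oppr0 expR0 -EFinB opprK addrC.
- exact: continuous_subspaceT.
- split.
  + by move=> x _; apply: (@ex_derive _ _ _ _ _ _ _ (dF x)).
  + by apply: cvg_at_right_filter; exact: cF.
  + by apply: cvg_at_left_filter; exact: cF.
- by move=> x _; rewrite derive1E; apply: (@derive_val _ _ _ _ _ _ _ (dF x)).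
Qed.

Let integral_nuE l t : 0 <= l -> 0 < t ->
  (\int[mu]_(x in `]0%R, t]) nuE l x =
   \int[mu]_s (beta s * (1 - expR (- (l * t * s))))%:E)%E.
Proof.
move=> l0 t0.
(* The indicator moves the domain []0, t]] into the integrand, so that Tonelli applies on the whole
   plane. *)
pose f (z : R * R) : \bar R := (\1_(`]0, t]%classic : set R) z.1 *
  (beta z.2 * (l * z.2 * expR (- (l * z.2 * z.1)))))%:E.
have f0 z : (0 <= f z)%E by rewrite lee_fin mulr_ge0 ?nuker_ge0.
have mf : measurable_fun [set: measurableTypeR R * measurableTypeR R] f.
  apply/measurable_EFinP; apply: measurable_funM; last exact: measurable_nuker.
  have m1 : measurable_fun setT (\1_(`]0, t]%classic : set R) : R -> R).
    exact: measurable_indic.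
  exact: (measurableT_comp m1).
transitivity (\int[mu]_x \int[mu]_s f (x, s))%E.
  rewrite integral_mkcond; apply: eq_integral => x _.
  rewrite patchE /f/=; case: ifP => xt.
    by rewrite /nuE; apply: eq_integral => s _; rewrite indicE xt mul1r.
  by rewrite integral0_eq// => s _; rewrite indicE xt mul0r.
rewrite fubini_tonelli//; apply: eq_integral => s _; rewrite /f/=.
have [s0|s0] := leP s 0.
  rewrite beta_eq0; last by left.
  by rewrite mul0r integral0_eq// => x _; rewrite mul0r mulr0.
rewrite (_ : l * t * s = l * s * t); last by ring.
rewrite EFinM -(integral_nuker l0 t0 s0) -ge0_integralZl//; last 3 first.
- apply/measurable_EFinP; apply: measurable_funM => //.
  apply: measurableT_comp => //; apply: measurableT_comp => //.
- by move=> x _; rewrite lee_fin !mulr_ge0 ?expR_ge0// ltW.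
- by rewrite lee_fin beta_ge0.
rewrite [RHS]integral_mkcond; apply: eq_integral => x _.
by rewrite patchE indicE; case: (x \in _); [rewrite mul1r EFinM|rewrite mul0r].
Qed.

Let integral_nu l t : 0 <= l -> 0 < t ->
  (\int[mu]_(x in `]-oo, t]) (nu l x)%:E =
  (C l * B - C l * \int[mu]_s (beta s * expR (- (l * t * s))))%:E)%E.
Proof.
move=> l0 t0.
have C0 : 0 <= C l by rewrite divr_ge0//; exact/ltW/prim_q_gt0.
have ie := integrable_beta_expR l0 (ltW t0).
transitivity ((C l)%:E * \int[mu]_(x in `]0%R, t]) nuE l x)%E.
  rewrite -ge0_integralZl//; last 2 first.
  - by apply: measurable_funTS; exact: measurable_nuE.
  - by move=> x _; apply: integral_ge0 => s _; rewrite lee_fin nuker_ge0.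
  rewrite [LHS]integral_mkcond [RHS]integral_mkcond; apply: eq_integral => x _.
  rewrite !patchE !mem_setE !in_itv/= /nu.
  have [x0 /=|x0 /=] := ltP 0 x; last by rewrite if_same.
  by case: ifP => // _; rewrite EFinM fineK// nuE_fin.
rewrite integral_nuE// -mulrBr [RHS]EFinM; congr (_ * _)%E.
rewrite EFinB /B /Rintegral !fineK; last 2 first.
- exact: integrable_fin_num.
- exact: integrable_fin_num.
rewrite -integralB_EFin//; apply: eq_integral => s _.
by rewrite -EFinB mulrBr mulr1.
Qed.

Let nu_ge0 l t : 0 <= l -> 0 <= nu l t.
Proof.
move=> l0; rewrite /nu; case: ifP => // _; rewrite mulr_ge0//.
  by rewrite divr_ge0//; exact/ltW/prim_q_gt0.
by rewrite fine_ge0// integral_ge0// => s _; rewrite lee_fin nuker_ge0.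
Qed.

Let causal_nu l : 0 <= l -> causal (nu l).
Proof.
move=> l0; split; first exact: measurable_nu.
  by move=> x x0; rewrite /nu ltNge x0.
move=> x0; pose x := Num.max x0 1.
have x_gt0 : 0 < x by rewrite lt_max ltr01 orbT.
suff : mu.-integrable `]-oo, x] (EFin \o nu l).
  apply: integrableS => //; apply: subset_itvl; rewrite bnd_simp.
  by rewrite le_max lexx.
apply/integrableP; split.
  by apply/measurable_EFinP; apply: measurable_funTS; exact: measurable_nu.
under eq_integral do rewrite /= ger0_norm ?nu_ge0//.
by rewrite integral_nu// ltry.
Qed.

Let prim_nu l t : 0 <= l -> 0 < t ->
  prim (nu l) t = C l * B - C l * \int[mu]_s (beta s * expR (- (l * t * s))).
Proof. by move=> l0 t0; rewrite /prim /Rintegral integral_nu. Qed.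

(** The damping rate is the integer [n], and [kappa0 n] is what [conv_kj] gives when the exponential
    is replaced by 1. The last two clauses serve the passage to the limit: a lower bound in which
    [k] itself appears, and mass concentrating at 0. *)
Lemma yosida_kernels : exists j nu : nat -> R -> R, exists kappa0 : nat -> R,
  [/\ forall n, causal (j n) /\ forall t, 0 <= j n t,
      forall n, causal (nu n) /\ forall t, 0 <= nu n t,
      forall n t, 0 < t -> conv (fun t => c * pow (- gamma) t) (j n) t =
                          kappa0 n - prim (nu n) t,
      forall n, prim (j n) T = 1 /\ forall t, 0 < t ->
        c * pow (- gamma) t * prim (j n) t <=
        conv (fun t => c * pow (- gamma) t) (j n) t &
      forall t, 0 < t -> t <= T -> prim (j n) t @[n --> \oo] --> (1 : R)].
Proof.
have g0 := gamma_gt0; have g1 := gamma_lt1.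
exists (fun n => j n%:R), (fun n => nu n%:R), (fun n => C n%:R * B); split.
- by move=> n; split => [|t]; [exact: causal_j|exact: j_ge0].
- by move=> n; split => [|t]; [exact: causal_nu|exact: nu_ge0].
- by move=> n t t0; rewrite conv_kj// prim_nu// opprB addrC subrK.
- move=> n; split; last by move=> t; exact: k_prim_le.
  by rewrite /j (primZ _ _ (causal_q _))// mulVf// gt_eqF// prim_q_gt0.
- exact: cvg_prim_j.
Qed.

End yosida_kernels.

(** * Convergence of j_n * W to W in L^1(0, T) *)

Section approximate_identity.
Context {R : realType}.
Local Notation mu := (@lebesgue_measure R).
Implicit Types (h W p w a f : R -> R) (t s d e M : R).

Let mle {x} : measurable (`]-oo, x]%classic : set R).
Proof. exact: measurable_itv. Qed.

(** The oscillation bound [e] is used against the mass of [j] on [[0, d]], the crude bound [2 * M]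
    against the mass on [[d, t]]. Only the mass up to [t] enters, hence the comparison with
    [h t * prim j t]. *)
Lemma conv_dist j h t d e M : causal j -> (forall s, 0 <= j s) -> causal h ->
  (forall s, `|h s| <= M) -> 0 <= e -> d <= t ->
  (forall s, 0 <= s -> s <= d -> `|h (t - s) - h t| <= e) ->
  `|conv j h t - h t * prim j t| <= e * prim j t + 2 * M * (prim j t - prim j d).
Proof.
move=> cj j0 ch hM e0 dt hd.
have [mj j0' ij] := cj; have [mh _ _] := ch.
have mht : measurable_fun setT (fun s => h (t - s)).
  by apply: (measurableT_comp mh); exact: measurable_funB.
have M0 : 0 <= M by exact: le_trans (hM 0).
have i1 : mu.-integrable `]-oo, t] (EFin \o (fun s => h (t - s) * j s)).
  have : mu.-integrable `]-oo, t] (fun s => M%:E * (j s)%:E)%E.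
    by apply: (integrableZl _ M (ij t)); exact: mle.
  apply: le_integrable => //.
    by apply/measurable_EFinP; apply: measurable_funTS; exact: measurable_funM.
  by move=> s _ /=; rewrite lee_fin !normrM (ger0_norm (j0 s)) (ger0_norm M0) ler_wpM2r.
have i2 : mu.-integrable `]-oo, t] (EFin \o (fun s => h t * j s)).
  by apply: (integrableZl _ (h t) (ij t)); exact: mle.
rewrite convC// conv_itv//.
rewrite -[X in _ - X](@RintegralZl _ _ _ mu _ _ (h t))//.
rewrite -RintegralB//.
have i3 : mu.-integrable `]-oo, t] (EFin \o (fun s => h (t - s) * j s - h t * j s)).
  by apply: (integrableB _ i1 i2); exact: mle.
apply: le_trans (le_normr_Rintegral _ i3) _; first exact: mle.
have cu := causal_upto d cj.
rewrite -(prim_upto j dt) -primB// -!primZ//; last exact: causalB.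
rewrite -primD//; last 2 first.
- exact: causalZ.
- by apply: causalZ; exact: causalB.
have [_ _ ir] : causal (fun x => e * j x + 2 * M * (j x - upto d j x)).
  by apply: causalD; apply: causalZ => //; exact: causalB.
apply: le_Rintegral => //.
  exact: (integrable_norm i3).
move=> s; rewrite /= in_itv/= => st; rewrite -mulrBl normrM (ger0_norm (j0 s)).
have [s0|s0] := leP s 0.
  by rewrite j0'// uptoE j0'// if_same subrr !mulr0 addr0.
rewrite uptoE; case: ifPn => sd.
  by rewrite subrr mulr0 addr0 ler_wpM2r// hd// ltW.
rewrite subr0 -mulrDl ler_wpM2r//.
apply: le_trans (ler_normB _ _) _.
by have := hM (t - s); have := hM t; lra.
Qed.

Lemma ae_neq x : {ae mu, forall t, t != x}.
Proof.
exists [set x]; split; [exact: measurable_set1|exact: lebesgue_measure_set1|].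
by move=> t /= /negP; rewrite negbK => /eqP.
Qed.

Lemma cvg_prim (f_ : nat -> R -> R) f g x : (forall n, causal (f_ n)) ->
  causal f -> causal g ->
  {ae mu, forall t, t < x -> f_ n t @[n --> \oo] --> f t} ->
  (forall n t, t <= x -> `|f_ n t| <= g t) ->
  prim (f_ n) x @[n --> \oo] --> prim f x.
Proof.
move=> cf_ [mf _ fi] [_ _ ig] f_f f_g.
have [||||_ _] := @dominated_convergence _ _ _ mu `]-oo, x]%classic mle
  (fun n t => (f_ n t)%:E) (EFin \o f) _ _ _ _ (ig x) _.
- move=> n; apply/measurable_EFinP; apply: measurable_funTS; by case: (cf_ n).
- by apply/measurable_EFinP; exact: measurable_funTS.
- move: f_f (ae_neq x); apply: filterS2; first exact: (ae_filter_ringOfSetsType mu).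
  move=> t ft tx; rewrite /= in_itv/= => tx'.
  apply: cvg_EFin; first exact: nearW.
  by apply: ft; rewrite lt_neqAle tx.
- apply: aeW => t n; rewrite /= in_itv/= => tx; rewrite lee_fin.
  exact: f_g.
- move=> h; apply: fine_cvg.
  by rewrite /prim /Rintegral fineK//; apply: integrable_fin_num (fi x).
Qed.

Lemma le_prim_ae a w x : causal a -> causal w ->
  {ae mu, forall t, t < x -> a t <= w t} -> prim a x <= prim w x.
Proof.
move=> ca cw aw; rewrite -subr_ge0 -primB//.
have cwa := causalB cw ca; have [m1 _ _] := cwa; have [m2 _ _] := causal_norm cwa.
rewrite (_ : prim _ x = prim (fun t => `|w t - a t|) x); first exact: prim_ge0.
congr fine; apply: ae_eq_integral => //.
- by apply/measurable_EFinP; exact: measurable_funTS.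
- by apply/measurable_EFinP; exact: measurable_funTS.
- move: aw (ae_neq x); apply: filterS2; first exact: (ae_filter_ringOfSetsType mu).
  move=> t aw tx; rewrite /= in_itv/= => tx'; rewrite ger0_norm// subr_ge0.
  by apply: aw; rewrite lt_neqAle tx.
Qed.

Lemma conv_norm_ae a w : causal a -> causal w -> (forall t, 0 <= a t) ->
  {ae mu, forall t, `|conv a w t| <= conv a (fun s => `|w s|) t}.
Proof.
move=> ca cw a0.
have := ae_integrable_conv ca cw; apply: filterS.
  exact: (ae_filter_ringOfSetsType mu).
move=> t it; apply: le_trans (le_normr_Rintegral _ it) _ => //.
rewrite le_eqVlt; apply/orP; left; apply/eqP.
by apply: eq_Rintegral => s _; rewrite normrM ger0_norm.
Qed.

Lemma conv_le_prim p w M t : causal p -> causal w -> (forall s, 0 <= w s) ->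
  (forall x, x <= t -> 0 <= p x <= M) -> conv p w t <= M * prim w t.
Proof.
move=> cp cw w0 pM; have [mp _ _] := cp; have [_ _ iw] := cw.
rewrite conv_itv// /prim -(@RintegralZl _ _ _ mu _ _ M)//.
have i1 : mu.-integrable `]-oo, t] (EFin \o (fun s => p (t - s) * w s)).
  apply: (@integrable_conv_bounded _ p w M) => // x xt.
  by have /andP[h1 h2] := pM _ xt; rewrite ger0_norm.
have i2 : mu.-integrable `]-oo, t] (EFin \o (fun s => M * w s)).
  by apply: (integrableZl _ M (iw t)); exact: mle.
apply: le_Rintegral => // s _.
have [s0|s0] := leP s 0; first by have [_ -> //] := cw; rewrite !mulr0.
by rewrite ler_wpM2r//; have /andP[] := pM (t - s) ltac:(lra).
Qed.

Section sequence.
Variables (j : nat -> R -> R) (T : R).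
Hypotheses (cj : forall n, causal (j n)) (j0 : forall n s, 0 <= j n s).
Hypothesis (jT : forall n, prim (j n) T = 1).
Hypothesis cvgj : forall t, 0 < t -> t <= T -> prim (j n) t @[n --> \oo] --> (1 : R).

Lemma prim_j_le1 n t : t <= T -> prim (j n) t <= 1.
Proof. by move=> tT; rewrite -(jT n); exact: le_prim. Qed.

Lemma cvg_conv h t M : causal h -> (forall s, `|h s| <= M) ->
  {for t, continuous h} -> 0 < t -> t <= T -> conv (j n) h t @[n --> \oo] --> h t.
Proof.
move=> ch hM ct t0 tT; apply/cvgrPdist_le => e e0.
have e30 : 0 < e / 3 by lra.
have M0 : 0 <= M by exact: le_trans (hM 0).
have [d [d0 dt hd]] : exists d, [/\ 0 < d, d <= t &
    forall s, 0 <= s -> s <= d -> `|h (t - s) - h t| <= e / 3].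
  move/cvgrPdist_le : ct => /(_ _ e30) /nbhs_ballP[r /= r0 hr].
  exists (Num.min (r / 2) t); split.
  - by rewrite lt_min t0 andbT; lra.
  - by rewrite ge_min lexx orbT.
  - move=> s s0; rewrite le_min => /andP[sr _]; rewrite distrC; apply: hr.
    by rewrite /ball/= opprB addrC subrK ger0_norm//; lra.
have dT := le_trans dt tT.
have M10 : 0 < M + 1 by lra.
(* The mass deficits at [d] and [t] get multiplied by [2 * M] and [M], so each contributes at most
   e/3; [M + 1] avoids a division by 0. *)
have c1 : \forall n \near \oo, `|1 - prim (j n) d| <= e / 3 / (2 * (M + 1)).
  have /cvgrPdist_le := cvgj d0 dT; apply; apply: divr_gt0 => //; lra.
have c2 : \forall n \near \oo, `|1 - prim (j n) t| <= e / 3 / (M + 1).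
  have /cvgrPdist_le := cvgj t0 tT; apply; exact: divr_gt0.
near=> n.
have h1 : `|1 - prim (j n) d| <= e / 3 / (2 * (M + 1)) by near: n.
have h2 : `|1 - prim (j n) t| <= e / 3 / (M + 1) by near: n.
have p1 := prim_j_le1 n tT; have p2 := prim_j_le1 n dT.
rewrite ger0_norm ?subr_ge0// ler_pdivlMr// in h1; last by lra.
rewrite ger0_norm ?subr_ge0// ler_pdivlMr// in h2.
have := conv_dist (cj n) (j0 n) ch hM (ltW e30) dt hd.
set A := conv _ _ _ => hA.
have -> : h t - A = h t * (1 - prim (j n) t) - (A - h t * prim (j n) t) by ring.
apply: le_trans (ler_normB _ _) _; rewrite normrM (@ger0_norm _ (1 - _)) ?subr_ge0//.
have k1 : `|h t| * (1 - prim (j n) t) <= M * (1 - prim (j n) t).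
  by rewrite ler_wpM2r ?subr_ge0.
nra.
Unshelve. all: by end_near. Qed.

Let nT f := prim (fun t => `|f t|) T.

Lemma conv_L1 n W : causal W -> nT (conv (j n) W) <= nT W.
Proof.
move=> cW; rewrite /nT.
have cnW := causal_norm cW; have cc := causal_conv (cj n) cW.
have ccn := causal_conv (cj n) cnW.
apply: (@le_trans _ _ (prim (conv (j n) (fun s => `|W s|)) T)).
  apply: le_prim_ae => //; first exact: causal_norm.
  have := conv_norm_ae (cj n) cW (j0 n); apply: filterS.
    exact: (ae_filter_ringOfSetsType mu).
  by [].
rewrite prim_conv// -[leRHS]mul1r; apply: conv_le_prim => //.
  exact: causal_prim.
by move=> x xT; rewrite prim_j_le1// andbT prim_ge0.
Qed.

Let nT_cvg h M : causal h -> (forall s, `|h s| <= M) -> 0 < T ->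
  (forall t, 0 < t < T -> {for t, continuous h}) ->
  nT (fun t => conv (j n) h t - h t) @[n --> \oo] --> (0 : R).
Proof.
move=> ch hM T0 hc.
have M0 : 0 <= M by exact: le_trans (hM 0).
have cpow0 : causal (@pow R 0) by apply: causal_pow; lra.
have cf n : causal (fun t => `|conv (j n) h t - h t|).
  by apply: causal_norm; apply: causalB => //; exact: causal_conv.
(* A dominating function independent of [n]. [conv_dist] with [d = 0], where the oscillation term is
   void, gives [2 * M], and the missing mass adds at most [M]. *)
have cg : causal (fun t => 4 * M * pow 0 t) by exact: causalZ.
rewrite -(_ : prim (cst 0) T = 0); last by rewrite /prim /Rintegral integral0.
have c0 : causal (cst (0 : R)).
  by split => // x; exact: integrable0.
apply: (cvg_prim cf c0 cg).
- apply: aeW => t tT; apply/cvgr0Pnorm_le => /= e e0.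
  have [t0|t0] := leP t 0.
    by apply: nearW => n; have [_ -> //] := cf n; rewrite normr0 ltW.
  have tT0 : 0 < t < T by rewrite t0.
  have /cvgrPdist_le/(_ _ e0) := cvg_conv ch hM (hc _ tT0) t0 (ltW tT).
  by apply: filterS => n; rewrite normr_id distrC.
- move=> n t tT; rewrite normr_id.
  have [t0|t0] := leP t 0.
    by have [_ -> //] := cf n; have [_ -> //] := cg.
  rewrite /pow t0 powRr0 mulr1.
  have hd s : 0 <= s -> s <= 0 -> `|h (t - s) - h t| <= 0.
    by move=> s0 s0'; rewrite (@le_anti _ _ s 0) ?s0 ?s0'// subr0 subrr normr0.
  have := conv_dist (cj n) (j0 n) ch hM (lexx 0) (ltW t0) hd.
  rewrite (prim_le0 (cj n) (lexx 0)) mul0r add0r subr0.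
  have p1 := prim_j_le1 n tT.
  have p0 : 0 <= prim (j n) t by apply: prim_ge0.
  set A := conv _ _ _ => hA.
  have -> : A - h t = (A - h t * prim (j n) t) - h t * (1 - prim (j n) t) by ring.
  apply: le_trans (ler_normB _ _) _; rewrite normrM (@ger0_norm _ (1 - _)) ?subr_ge0//.
  have k1 : `|h t| * (1 - prim (j n) t) <= M * (1 - prim (j n) t).
    by rewrite ler_wpM2r ?subr_ge0.
  nra.
Qed.

(** Continuous functions are dense in L^1(0, T), and convolution with [j n] is a contraction
    there. *)
Lemma conv_cvg_L1 W : 0 < T -> causal W -> (forall t, T <= t -> W t = 0) ->
  nT (fun t => conv (j n) W t - W t) @[n --> \oo] --> (0 : R).
Proof.
move=> T0 cW WT; apply/cvgr0Pnorm_le => /= e e0.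
have [mW W0 iW] := cW.
have mD : measurable (`]0, T[%classic : set R) by exact: measurable_itv.
have iWD : mu.-integrable `]0, T[ (EFin \o W).
  apply: integrableS (iW T) => // x /=; rewrite !in_itv/= => /andP[_].
  exact: ltW.
have muD : (mu (`]0%R, T[%classic : set R) < +oo)%E.
  by rewrite lebesgue_measure_itv/=; case: ifP => _; rewrite -?EFinB ltry.
have [g_ [cg ig /fine_cvgP[gfin /cvgrPdist_lt gW]]] :=
  @approximation_continuous_integrable _ `]0, T[%classic W mD
  muD iWD.
have e4 : 0 < e / 4 by lra.
have [g [{}cg {}ig {}gW]] : exists g, [/\ continuous g,
    mu.-integrable `]0, T[ (EFin \o g) &
    \int[mu]_(t in `]0, T[) `|W t - g t| <= e / 4].
  near \oo => n; exists (g_ n); split => //.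
  have : `|0 - fine (\int[mu]_(z in `]0, T[) `|(W z - g_ n z)%:E|)| < e / 4.
    by near: n; exact: gW.
  rewrite sub0r normrN => /ltW; apply: le_trans; exact: ler_norm.
(* The cut makes [g] causal at the cost of possible jumps at 0 and [T], which is why [nT_cvg] asks
   for continuity inside (0, T) only. *)
pose h := g \_ `]0, T[%classic.
have hE t : h t = if 0 < t < T then g t else 0.
  by rewrite /h patchE mem_setE in_itv.
have ih : mu.-integrable setT (EFin \o h).
  by rewrite -restrict_EFin; exact: (@integrable_mkcond _ _ _ mu _ (EFin \o g) mD).1.
have ch : causal h.
  split; first by apply/measurable_EFinP; exact: (measurable_int _ ih).
    by move=> x x0; rewrite hE ltNge x0.
  by move=> x; apply: integrableS ih.
have [c _ hc] := EVT_max (ltW T0) (continuous_subspaceT (fun x => cvg_norm (cg x))).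
have hM t : `|h t| <= `|g c|.
  rewrite hE; case: ifP => [/andP[t0 tT]|_]; last by rewrite normr0.
  by apply: hc; rewrite in_itv/= !ltW.
have hct t : 0 < t < T -> {for t, continuous h}.
  move=> /andP[t0 tT]; rewrite /prop_for /continuous_at hE t0 tT/=.
  apply: cvg_trans (cg t); apply: near_eq_cvg; near=> x; rewrite hE ifT//.
  by apply/andP; split; near: x; [exact: lt_nbhsr|exact: lt_nbhsl].
have hcvg := nT_cvg ch hM T0 hct.
have Wh : nT (fun t => W t - h t) <= e / 4.
  apply: le_trans gW; rewrite le_eqVlt; apply/orP; left; apply/eqP.
  rewrite /nT /prim Rintegral_mkcond [RHS]Rintegral_mkcond.
  apply: eq_Rintegral => t _; rewrite !patchE !mem_setE !in_itv/= hE.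
  have [t0|t0] /= := ltP 0 t; last by rewrite W0// subrr normr0 if_same.
  have [tT|tT] := ltP t T; first by rewrite ltW.
  by rewrite WT// subrr normr0 if_same.
have e2 : 0 < e / 2 by lra.
move/cvgr0Pnorm_le : hcvg => /(_ _ e2); apply: filterS => n hn.
have cWh := causalB cW ch.
have cjW := causal_conv (cj n) cW; have cjh := causal_conv (cj n) ch.
have cjWh := causal_conv (cj n) cWh.
have nT0 f : 0 <= nT f by apply: prim_ge0.
rewrite ger0_norm//.
have h1 := conv_L1 n cWh.
(* The three terms are at most e/4 by the contraction [conv_L1], e/2 by [nT_cvg] and e/4 by the
   choice of [g]. *)
apply: (@le_trans _ _ (nT (conv (j n) (fun t => W t - h t)) +
  nT (fun t => conv (j n) h t - h t) + nT (fun t => W t - h t))); last first.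
  by have := ler_norm (nT (fun t => conv (j n) h t - h t)); lra.
have b1 := causal_norm cjWh; have b2 := causal_norm (causalB cjh ch).
have b3 := causal_norm cWh.
rewrite /nT -!primD//; last exact: causalD.
apply: le_prim_ae.
- by apply: causal_norm; exact: causalB.
- by apply: causalD => //; exact: causalD.
have := ae_integrable_conv (cj n) cW.
have := ae_integrable_conv (cj n) ch.
apply: filterS2; first exact: (ae_filter_ringOfSetsType mu).
move=> t it1 it2 _.
have -> : conv (j n) (fun t => W t - h t) t = conv (j n) W t - conv (j n) h t.
  rewrite /conv -RintegralB//; apply: eq_Rintegral => s _; exact: mulrBr.
rewrite (_ : conv (j n) W t - W t = (conv (j n) W t - conv (j n) h t) +
  (conv (j n) h t - h t) - (W t - h t)); last by ring.
by apply: le_trans (ler_normB _ _) _; rewrite lerD2r ler_normD.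
Unshelve. all: by end_near. Qed.

End sequence.

End approximate_identity.

(** * Integrals of functions that may fail to be measurable *)

Section lower_integral.
Context d (T : measurableType d) (R : realType).
Variable mu : {measure set T -> \bar R}.
Local Open Scope ereal_scope.
Import HBNNSimple.

(** The integral of a nonnegative function is a supremum over the simple
    functions below it, whence no measurability is needed. *)
Lemma ge0_le_integral_nonmeasurable (D : set T) (f1 f2 : T -> \bar R) :
  (forall x, D x -> 0 <= f1 x) -> (forall x, D x -> f1 x <= f2 x) ->
  \int[mu]_(x in D) f1 x <= \int[mu]_(x in D) f2 x.
Proof.
move=> f10 f12.
have f20 x : D x -> 0 <= f2 x by move=> Dx; exact: le_trans (f10 _ Dx) (f12 _ Dx).
rewrite !ge0_integralE//; apply: ereal_sup_le => _ [h hf <-]; exists h => // x.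
apply: le_trans (hf x) _; rewrite !patchE; case: ifPn => //; rewrite inE.
exact: f12.
Qed.

(** The simple functions below [f] are measurable, so a null set can be removed from each of them,
    and then from their supremum. *)
Lemma ge0_integral_setD_null (D A : set T) (f : T -> \bar R) : measurable A ->
  mu A = 0 -> (forall x, D x -> 0 <= f x) ->
  \int[mu]_(x in D) f x = \int[mu]_(x in D `\` A) f x.
Proof.
move=> mA A0 f0; apply/eqP; rewrite eq_le; apply/andP; split; last first.
  rewrite integral_mkcond [leRHS]integral_mkcond.
  apply: ge0_le_integral_nonmeasurable => x _.
    by rewrite patchE; case: ifPn => //; rewrite inE => -[Dx _]; exact: f0.
  rewrite !patchE; case: ifPn; first by rewrite inE => -[Dx _]; rewrite mem_set.
  by move=> _; case: ifPn => //; rewrite inE; exact: f0.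
rewrite ge0_integralE//; apply: ge_ereal_sup => _ [h hf <-].
rewrite -integralT_nnsfun (ge0_negligible_integral mA)//; last 2 first.
- by apply/measurable_EFinP.
- by move=> x _; rewrite lee_fin.
rewrite integral_mkcond [leRHS]integral_mkcond.
apply: ge0_le_integral_nonmeasurable => x _.
  by rewrite patchE; case: ifPn => // _; rewrite lee_fin.
have := hf x; rewrite !patchE; have [Dx|Dx] := boolP (x \in D).
  by rewrite !in_setD Dx in_setT; case: (x \notin A).
rewrite !in_setD (negPf Dx) in_setT/=; by case: (x \notin A).
Qed.

Lemma integral_setD_null (D A : set T) (f : T -> \bar R) : measurable A ->
  mu A = 0 -> \int[mu]_(x in D) f x = \int[mu]_(x in D `\` A) f x.
Proof.
move=> mA A0; rewrite integralE [RHS]integralE.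
by congr (_ - _); apply: ge0_integral_setD_null.
Qed.

End lower_integral.

(** * Everywhere limits of simple functions and Carathéodory composition *)

Section strong_measurability.
Context {R : realType} {X : normedModType R}.
Local Notation mu := (@lebesgue_measure R).
Implicit Types (s : nat -> R -> X) (f : R -> X) (h : R -> X -> R).

Definition simple_limit s f : Prop :=
  (forall n, simple_function (s n)) /\ (forall t, s n t @[n --> \oo] --> f t).

Lemma measurable_comp_simple (b : R -> X) h : simple_function b ->
  (forall x, measurable_fun setT (h^~ x)) ->
  measurable_fun setT (fun t => h t (b t)).
Proof.
move=> [fb mb] mh _ B mB; rewrite setTI.
rewrite (_ : _ @^-1` B = \bigcup_(x in range b) (b @^-1` [set x] `&` (h^~ x) @^-1` B)).
  apply: fin_bigcup_measurable => // x _; apply: measurableI; first exact: mb.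
  by rewrite -[_ @^-1` _]setTI; exact: mh.
apply/seteqP; split => [t Bt|t [x _ [/= <-]]//].
by exists (b t); [exists t|].
Qed.

Lemma measurable_caratheodory s f h : simple_limit s f ->
  (forall x, measurable_fun setT (h^~ x)) ->
  (forall t, {for f t, continuous (h t)}) ->
  measurable_fun setT (fun t => h t (f t)).
Proof.
move=> [ss sf] mh ch.
apply: (@measurable_fun_cvg _ _ _ setT (fun n t => h t (s n t))).
  by move=> n; exact: measurable_comp_simple.
by move=> t _; apply: (cvg_comp (s^~ t) (h t) (sf t)); exact: ch.
Qed.

Lemma measurable_simple_limit s f (p : X -> R) : simple_limit s f ->
  continuous p -> measurable_fun setT (p \o f).
Proof.
move=> sf cp; apply: (measurable_caratheodory (h := fun=> p) sf) => //.
by move=> t; exact: cp.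
Qed.

Let ae_finite (F : set X) (P : X -> R -> Prop) : finite_set F ->
  (forall x, {ae mu, forall t, P x t}) ->
  {ae mu, forall t, forall x, F x -> P x t}.
Proof.
move=> /finite_seqP[l ->] aeP; elim: l => [|x l ih].
  by apply: aeW => t x.
have := aeP x; move: ih; apply: filterS2.
  exact: (ae_filter_ringOfSetsType mu).
move=> t ih Px y /=; rewrite inE => /orP[/eqP -> //|]; exact: ih.
Qed.

(** Used to put [v := f t] in identities valid for a.e. [t], with a null set
    depending on the fixed vector [v]. *)
Lemma ae_eq0_caratheodory s f h (D : set R) : simple_limit s f ->
  (forall x, {ae mu, forall t, D t -> h t x = 0}) ->
  {ae mu, forall t, D t -> continuous (h t)} ->
  {ae mu, forall t, D t -> h t (f t) = 0}.
Proof.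
move=> [ss sf] h0 ch.
have : {ae mu, forall t, forall n, forall x, range (s n) x -> D t -> h t x = 0}.
  by apply/ae_foralln => n; apply: ae_finite => //; case: (ss n).
move: ch; apply: filterS2; first exact: (ae_filter_ringOfSetsType mu).
move=> t ch hs Dt.
have h1 : h t (s n t) @[n --> \oo] --> h t (f t).
  by apply: (cvg_comp (s^~ t) (h t) (sf t)); exact: ch.
have h2 : h t (s n t) @[n --> \oo] --> (0 : R).
  by apply: cvg_near_cst; apply: nearW => n; apply: (hs n) => //; exists t.
exact: (cvg_unique _ h1 h2).
Qed.

(** [A] contains the points where convergence fails. The larger set [B] is left to the user, so that
    several functions can share one exceptional set. The bound on [s n] is there for dominated
    convergence. *)
Lemma strongly_measurable_simple_limit (D : set R) f : measurable D ->
  strongly_measurable D f -> exists A, [/\ measurable A, mu A = 0%E &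
    forall B, measurable B -> A `<=` B -> exists2 s,
      simple_limit s (fun t => if t \in D `\` B then f t else 0) &
      forall n t, `|s n t| <= 2 * `|if t \in D `\` B then f t else 0| ].
Proof.
move=> mD [s ss [A [mA A0 sA]]]; exists A; split => // B mB AB.
pose E := D `\` B; have mE : measurable E by exact: measurableD.
pose g t : X := if t \in E then f t else 0.
pose s1 n t : X := if t \in E then s n t else 0.
have simple_if (M : set R) (b : R -> X) : measurable M -> simple_function b ->
    simple_function (fun t => if t \in M then b t else 0).
  move=> mM [fb mb]; split.
    apply: (@sub_finite_set _ _ (range b `|` [set 0])).
      move=> _ [t _ <-]; case: ifP => _; [by left; exists t|by right].
    by rewrite finite_setU; split.
  move=> x; rewrite (_ : _ @^-1` _ = (M `&` b @^-1` [set x]) `|`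
      (~` M `&` (fun=> 0) @^-1` [set x])).
    apply: measurableU; first by apply: measurableI.
    apply: measurableI; first exact: measurableC.
    have [->|x0] := eqVneq x 0.
      by rewrite (_ : _ @^-1` _ = setT)//; apply/seteqP; split.
    rewrite (_ : _ @^-1` _ = set0)//; apply/seteqP; split => // t /= /esym/eqP.
    by rewrite (negPf x0).
  apply/seteqP; split => t /=.
    by case: ifPn; rewrite ?inE ?notin_setE => h1 h2; [left|right].
  by case: ifPn; rewrite ?inE ?notin_setE => h1 [|] [].
have lim1 : simple_limit s1 g.
  split=> [n|t]; first exact: simple_if.
  rewrite /g /s1; case: ifPn => tE; last exact: cvg_cst.
  move: tE; rewrite inE => -[Dt Bt]; apply: contrapT => nt; apply: Bt; apply: AB.
  by apply: sA => /(_ Dt).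
have mg : measurable_fun setT (fun t => `|g t|).
  apply: (measurable_simple_limit (p := Num.norm) lim1) => x; exact: cvg_norm.
(* Values outside this set are replaced by 0. Where [g t] is nonzero, eventually
   [|s1 n t - g t| <= |g t|], whence the factor 2; where [g t = 0], all truncated values are 0. *)
pose M n := [set t | `|s1 n t| <= 2 * `|g t| ].
have mM n : measurable (M n).
  have m1 : measurable_fun setT (fun t => `|s1 n t|).
    by apply: (measurable_comp_simple (h := fun=> Num.norm)) => //; exact: simple_if.
  have : measurable_fun setT (fun t => `|s1 n t| <= 2 * `|g t|).
    by apply: measurable_fun_ler => //; exact: measurable_funM.
  by move=> /(_ measurableT [set true] I); rewrite setTI.
exists (fun n t => if t \in M n then s1 n t else 0); last first.
  move=> n t; case: ifPn; first by rewrite inE.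
  by rewrite normr0 mulr_ge0.
split=> [n|t]; first by apply: simple_if => //; case: lim1.
have [gt0|gt0] := eqVneq (g t) 0.
  rewrite -/(g t) gt0; apply: cvg_near_cst; apply: nearW => n.
  case: ifPn => //; rewrite inE /M/= gt0 normr0 mulr0 normr_le0 => /eqP ->.
  by [].
have [_ /(_ t) h1] := lim1.
apply: cvg_trans h1; apply: near_eq_cvg.
have ng0 : 0 < `|g t| by rewrite normr_gt0.
have [_ /(_ t)/cvgrPdist_le/(_ _ ng0)] := lim1.
apply: filterS => n hn; rewrite ifT// inE /M/=.
rewrite -[s1 n t](subrK (g t)) mulr2n mulrDl mul1r.
apply: le_trans (ler_normD _ _) _; rewrite lerD2r distrC.
exact: hn.
Qed.

End strong_measurability.

(** * Operator norm bounds and Lipschitz continuity *)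

Section dual_bounds.
Context {R : realType} {V : normedModType R}.
Implicit Types (l : dual V) (v : V).

Lemma dual_le l v : `|l v| <= `|l| * `|v|.
Proof.
have [->|v0] := eqVneq v 0; first by rewrite linear0 !normr0 mulr0.
have nv : 0 < `|v| by rewrite normr_gt0.
rewrite -ler_pdivrMr//.
have -> : `|l v| / `|v| = `|l (`|v|^-1 *: v)|.
  by rewrite linearZ/= normrM normfV normr_id mulrC.
apply: ub_le_sup.
  have /linear_boundedP/pinfty_ex_gt0[M M0 lM] :=
    continuous_linear_bounded 0 (@dual_continuous _ _ l 0).
  by exists M => _ [w w1 <-]; apply: le_trans (lM w) _; rewrite ler_piMr// ltW.
exists (`|v|^-1 *: v) => //=.
by rewrite normrZ normfV normr_id mulVf// gt_eqF.
Qed.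

Lemma lipschitz_continuous {X : normedModType R} (f : X -> R) (K : R) :
  (forall x y, `|f x - f y| <= K * `|x - y|) -> continuous f.
Proof.
move=> fK x; apply/cvgrPdist_le => e e0.
have K1 : 0 < `|K| + 1 by rewrite ltr_wpDl.
near=> y; apply: le_trans (fK x y) _.
apply: (@le_trans _ _ ((`|K| + 1) * `|x - y|)).
  by rewrite ler_wpM2r// (le_trans (ler_norm K))// lerDl.
rewrite -ler_pdivlMl//; near: y.
apply: cvgr_dist_le; first exact: cvg_id.
by rewrite mulr_gt0// invr_gt0.
Unshelve. all: by end_near. Qed.

Lemma dual_eval_continuous v : continuous (fun l : dual V => l v).
Proof.
apply: (@lipschitz_continuous _ _ `|v|) => l m.
by rewrite mulrC -[l v - m v]/((l - m) v) dual_le.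
Qed.

End dual_bounds.

(** * Causality by domination *)

Section causal_domination.
Context {R : realType}.
Local Notation mu := (@lebesgue_measure R).
Implicit Types (f p : R -> R) (T : R).

Lemma ae_and (P Q : R -> Prop) : {ae mu, forall t, P t} ->
  {ae mu, forall t, Q t} -> {ae mu, forall t, P t /\ Q t}.
Proof.
by apply: filterS2; first exact: (ae_filter_ringOfSetsType mu).
Qed.

Lemma le_causal f p : measurable_fun setT f -> causal p ->
  (forall t, `|f t| <= p t) -> causal f.
Proof.
move=> mf [_ p0 ip] fp; split => //.
  by move=> x x0; apply/eqP; rewrite -normr_le0 -(p0 x)//.
move=> x; apply: le_integrable (ip x) => //.
  by apply/measurable_EFinP; exact: measurable_funTS.
by move=> t _ /=; rewrite lee_fin (le_trans (fp t))// ler_norm.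
Qed.

(** Multiplying by this cut-off makes the constant initial value causal and zero after [T]. *)
Definition theta T (t : R) : R := if 0 < t < T then 1 else 0.

Lemma causal_theta T : causal (theta T).
Proof.
have i := @integrable_indic_itv R 0 T false true.
rewrite (_ : theta T = \1_(`]0, T[%classic : set R)); last first.
  by apply/funext => t; rewrite indicE mem_setE in_itv /theta; case: ifP.
split.
- exact: measurable_indic.
- by move=> x x0; rewrite indicE mem_setE in_itv/= ltNge x0.
- by move=> x; apply: integrableS i.
Qed.

Lemma theta_ge0 T t : 0 <= theta T t. Proof. by rewrite /theta; case: ifP. Qed.

(** L^2 is contained in L^1 on a bounded interval, by [f <= 1 + f^2]. *)
Lemma causal_sqr f T : measurable_fun setT f -> (forall t, 0 <= f t) ->
  causal (fun t => f t ^+ 2) -> (forall t, ~~ (0 < t < T) -> f t = 0) -> causal f.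
Proof.
move=> mf f_ge0 cf2 f0.
apply: (le_causal (p := fun t => theta T t + f t ^+ 2)) => //.
  by apply: causalD => //; exact: causal_theta.
move=> t; rewrite ger0_norm// /theta; case: ifPn => tT; first by nra.
by rewrite f0// expr0n addr0.
Qed.

End causal_domination.

Section conv_family.
Context {R : realType} {X : normedModType R}.
Local Notation mu := (@lebesgue_measure R).

(** Supplies the continuity in the vector that [ae_eq0_caratheodory] asks for. The time [t] is
    restricted only through the dominating function [p], hence independently of the vector. *)
Lemma conv_lipschitz (a p : R -> R) (F : X -> R -> R) t :
  measurable_fun setT a -> (forall s, 0 <= a s) ->
  (forall x, measurable_fun setT (F x)) ->
  (forall x s, `|F x s| <= p s * `|x|) ->
  (forall x y s, F x s - F y s = F (x - y) s) ->
  mu.-integrable setT (fun s => (a (t - s) * p s)%:E) ->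
  forall x y, `|conv a (F x) t - conv a (F y) t| <= conv a p t * `|x - y|.
Proof.
move=> ma a0 mF Fp FB ip x y.
have mat : measurable_fun setT (fun s : R => a (t - s)).
  by apply: (measurableT_comp ma); exact: measurable_funB.
have iF z : mu.-integrable setT (EFin \o (fun s => a (t - s) * F z s)).
  have := integrableZr measurableT `|z| ip; apply: le_integrable => //.
    by apply/measurable_EFinP; exact: (measurable_funM mat (mF z)).
  move=> s _ /=; rewrite lee_fin normrM (ger0_norm (a0 _)).
  by rewrite (le_trans _ (ler_norm _))// -mulrA ler_wpM2l.
rewrite /conv -RintegralB// -RintegralZr//.
have iB : mu.-integrable setT
    (EFin \o (fun s => a (t - s) * F x s - a (t - s) * F y s)).
  exact: (integrableB measurableT (iF x) (iF y)).
apply: le_trans (le_normr_Rintegral measurableT iB) _.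
apply: le_Rintegral => //.
- exact: (integrable_norm iB).
- exact: (integrableZr measurableT `|x - y| ip).
- by move=> s _; rewrite -mulrBr FB normrM (ger0_norm (a0 _)) -mulrA ler_wpM2l.
Qed.

End conv_family.

Lemma causal_pairing {R : realType} {V : normedModType R} (su : nat -> R -> V)
    (ut : R -> V) (sw : nat -> R -> dual V) (wt : R -> dual V) :
  simple_limit su ut -> simple_limit sw wt ->
  causal (fun t => `|ut t| ^+ 2) -> causal (fun t => `|wt t| ^+ 2) ->
  causal (fun t => wt t (ut t)).
Proof.
move=> lim_u lim_w cu2 cw2.
apply: (le_causal (p := fun t => `|wt t| ^+ 2 + `|ut t| ^+ 2)).
- apply: (measurable_caratheodory (h := fun t v => wt t v) lim_u) => //.
    by move=> v; exact: (measurable_simple_limit lim_w (@dual_eval_continuous _ _ v)).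
  by move=> t; exact: dual_continuous.
- exact: causalD.
- move=> t; apply: le_trans (dual_le _ _) _.
  have := sqr_ge0 (`|wt t| - `|ut t|); have := normr_ge0 (wt t).
  by have := normr_ge0 (ut t); nra.
Qed.

(** * The energy inequality for a regularised kernel, and its limit *)

Section energy_estimate.
Context {R : realType} {V H : hilbertType R} (G : gelfand V H).
Local Notation mu := (@lebesgue_measure R).
Variables (T : R) (k : R -> R) (u0 : H) (ut : R -> V) (wt : R -> dual V).
Variables (su : nat -> R -> V) (sw : nat -> R -> dual V).
Hypotheses (T_gt0 : 0 < T) (ck : causal k) (k0 : forall t, 0 <= k t).
Hypotheses (lim_u : simple_limit su ut) (lim_w : simple_limit sw wt).
Hypotheses (u_out : forall t, ~~ (0 < t < T) -> ut t = 0)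
           (w_out : forall t, ~~ (0 < t < T) -> wt t = 0).
Hypotheses (cu2 : causal (fun t => `|ut t| ^+ 2))
           (cw2 : causal (fun t => `|wt t| ^+ 2)).
Hypothesis su_le : forall n t, `|su n t| <= 2 * `|ut t|.

Let W v t : R := wt t v.
Let g v t : R := inner (G (ut t)) (G v) - theta T t * inner u0 (G v).
Let U t : R := `|G (ut t)| ^+ 2.

Hypothesis caputo_ug : forall v phi, test_function T phi ->
  \int[mu]_(t in `]0, T[) (W v t * phi t) = - \int[mu]_(t in `]0, T[)
   (g v t * derive1 (fun r => \int[mu]_(t in `]r, T[) (k (t - r) * phi t)) t).

Let norm_cont (X : normedModType R) : continuous (Num.norm : X -> R).
Proof. by move=> x; exact: cvg_norm. Qed.

Let mu_norm : measurable_fun setT (fun t => `|ut t|).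
Proof. exact: (measurable_simple_limit lim_u (@norm_cont _)). Qed.

Let mw_norm : measurable_fun setT (fun t => `|wt t|).
Proof. exact: (measurable_simple_limit lim_w (@norm_cont _)). Qed.

Let cw_norm : causal (fun t => `|wt t|).
Proof.
by apply: (causal_sqr (T := T)) => // t tT; rewrite w_out// normr0.
Qed.

Let cu_norm : causal (fun t => `|ut t|).
Proof.
by apply: (causal_sqr (T := T)) => // t tT; rewrite u_out// normr0.
Qed.

Let bound_G : exists2 M, 0 <= M & forall v, `|G v| <= M * `|v|.
Proof.
have /linear_boundedP/pinfty_ex_gt0[M M0 GM] :=
  continuous_linear_bounded 0 (@emb_continuous _ _ _ G 0).
by exists M => //; exact: ltW.
Qed.

Let W_le v t : `|W v t| <= `|wt t| * `|v|. Proof. exact: dual_le. Qed.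

Let mW v : measurable_fun setT (W v).
Proof. exact: (measurable_simple_limit lim_w (@dual_eval_continuous _ _ v)). Qed.

Let cW v : causal (W v).
Proof.
apply: (le_causal (p := fun t => `|v| * `|wt t|)) => //.
  exact: causalZ.
by move=> t; rewrite mulrC.
Qed.

Let continuous_inner (h : H) : continuous (fun v => inner h (G v)).
Proof.
have [M M0 GM] := bound_G.
apply: (@lipschitz_continuous _ _ _ (`|h| * M)) => v v'.
rewrite -mulrA -mulN1r -innerZr -innerDr -linearZ -linearD scaleN1r.
by apply: le_trans (inner_CS _ _) _; rewrite ler_wpM2l.
Qed.

Let mg v : measurable_fun setT (g v).
Proof.
apply: measurable_funB.
  apply: (measurable_simple_limit (p := fun x => inner (G x) (G v)) lim_u).
  under eq_fun do rewrite innerC; exact: continuous_inner.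
by apply: measurable_funM => //; have [] := causal_theta T.
Qed.

Let cU : causal U.
Proof.
have [M M0 GM] := bound_G.
apply: (le_causal (p := fun t => M ^+ 2 * `|ut t| ^+ 2)).
- apply: measurable_funX; apply: (measurable_simple_limit (p := fun x => `|G x|) lim_u).
  apply: (@lipschitz_continuous _ _ _ M) => v v'.
  by apply: le_trans (ler_dist_dist _ _) _; rewrite -linearB GM.
- exact: causalZ.
- move=> t; rewrite ger0_norm ?sqr_ge0// /U -exprMn ler_sqr ?nnegrE ?mulr_ge0//.
Qed.

Let U_ge0 t : 0 <= U t. Proof. exact: sqr_ge0. Qed.

Let phi_g t : R := `|G (ut t)| + `|u0| * theta T t.

Let cGu : causal (fun t => `|G (ut t)|).
Proof.
have [M M0 GM] := bound_G.
apply: (le_causal (p := fun t => M * `|ut t|)).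
- apply: (measurable_simple_limit (p := fun x => `|G x|) lim_u).
  apply: (@lipschitz_continuous _ _ _ M) => v v'.
  by apply: le_trans (ler_dist_dist _ _) _; rewrite -linearB GM.
- exact: causalZ.
- by move=> t; rewrite normr_id.
Qed.

Let cphi_g : causal phi_g.
Proof. by apply: causalD => //; apply: causalZ; exact: causal_theta. Qed.

Let g_le v t : `|g v t| <= phi_g t * `|G v|.
Proof.
rewrite /g /phi_g mulrDl; apply: le_trans (ler_normB _ _) _; apply: lerD.
  exact: inner_CS.
rewrite normrM (ger0_norm (theta_ge0 _ _)) [`|u0| * _]mulrC -mulrA.
by rewrite ler_wpM2l ?theta_ge0// inner_CS.
Qed.

Let cg v : causal (g v).
Proof.
apply: (le_causal (p := fun t => `|G v| * phi_g t)) => //.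
  exact: causalZ.
by move=> t; rewrite mulrC.
Qed.

(** Writing a mass as a convolution allows constants to be compared with the other terms under one
    integral. *)
Let conv_theta a t : causal a -> t < T -> conv a (theta T) t = prim a t.
Proof.
move=> ca tT; have [ma a0 ia] := ca.
rewrite convC//; last by have [] := causal_theta T.
rewrite conv_itv//; last exact: causal_theta.
rewrite /prim -!Rintegral_itv_bndo_bndc; last 2 first.
- by apply: integrableS (ia t) => // x /=; rewrite !in_itv/=; exact: ltW.
- apply: (@integrableS _ _ _ mu `]-oo, t]) => //.
    by move=> x /=; rewrite !in_itv/=; exact: ltW.
  apply: (@integrable_conv_bounded _ (theta T) a 1) => //.
    by have [] := causal_theta T.
  by move=> x _; rewrite /theta; case: ifP; rewrite ?normr1 ?normr0.
apply: eq_Rintegral => s; rewrite inE/= in_itv/= => st.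
have [s0|s0] := leP s 0; first by rewrite a0// mulr0.
by rewrite /theta ifT ?mul1r//; apply/andP; split; lra.
Qed.

Section one_kernel.
Variables (j nu : R -> R) (kappa0 : R).
Hypotheses (cj : causal j) (j0 : forall t, 0 <= j t) (jT : prim j T = 1).
Hypotheses (cnu : causal nu) (nu0 : forall t, 0 <= nu t).
Hypothesis kappaE : forall t, 0 < t -> conv k j t = kappa0 - prim nu t.

Let prim_j_le t : t <= T -> prim j t <= 1.
Proof. by move=> tT; rewrite -jT; exact: le_prim. Qed.

(** Young's inequality with weight [lam], then [prim j t <= 1]. *)
Let conv_young t z lam : 0 < lam -> 0 <= z -> t < T ->
  mu.-integrable setT (fun s => (j (t - s) * `|wt s|)%:E) ->
  mu.-integrable setT (fun s => (j (t - s) * `|wt s| ^+ 2)%:E) ->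
  mu.-integrable setT (fun s => (j (t - s) * theta T s)%:E) ->
  conv j (fun s => `|wt s|) t * z <=
    2^-1 * (lam * conv j (fun s => `|wt s| ^+ 2) t + lam^-1 * z ^+ 2).
Proof.
move=> lam0 z0 tT i1 i2 i3.
have li0 : 0 < lam^-1 by rewrite invr_gt0.
apply: (@le_trans _ _ (2^-1 * lam * conv j (fun s => `|wt s| ^+ 2) t +
    2^-1 * lam^-1 * z ^+ 2 * conv j (theta T) t)); last first.
  rewrite mulrDr !mulrA lerD2l conv_theta//.
  by rewrite ler_piMr ?(prim_j_le (ltW tT))// !mulr_ge0 ?exprn_ge0// ltW.
have i2' := integrableZl measurableT (2^-1 * lam) i2.
have i3' := integrableZl measurableT (2^-1 * lam^-1 * z ^+ 2) i3.
have i1' := integrableZr measurableT z i1.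
rewrite /conv -RintegralZr// -!RintegralZl// -RintegralD//.
apply: le_Rintegral => //; first exact: (integrableD measurableT i2' i3').
move=> s _.
have [sT|sT] := boolP (0 < s < T); last first.
  rewrite w_out// normr0 expr0n !mulr0 mul0r add0r.
  by rewrite !mulr_ge0 ?theta_ge0 ?exprn_ge0 ?(ltW li0).
rewrite /theta sT mulr1.
have -> : 2^-1 * lam * (j (t - s) * `|wt s| ^+ 2) + 2^-1 * lam^-1 * z ^+ 2 * j (t - s)
  = j (t - s) * (2^-1 * (lam * `|wt s| ^+ 2 + lam^-1 * z ^+ 2)) by ring.
rewrite -mulrA ler_wpM2l// -subr_ge0.
rewrite (_ : _ - _ = 2^-1 * lam^-1 * (lam * `|wt s| - z) ^+ 2).
  by apply: mulr_ge0; [rewrite mulr_ge0 ?(ltW li0)|exact: sqr_ge0].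
by field; rewrite gt_eqF.
Qed.

(** 2 (Gu(s), x)_H <= |Gu(s)|^2 + |x|^2, and [nu >= 0]. *)
Let conv_nu_le t x : t < T ->
  mu.-integrable setT (fun s => (nu (t - s) * g x s)%:E) ->
  mu.-integrable setT (fun s => (nu (t - s) * U s)%:E) ->
  mu.-integrable setT (fun s => (nu (t - s) * theta T s)%:E) ->
  conv nu (g x) t <= 2^-1 * conv nu U t +
    (2^-1 * `|G x| ^+ 2 - inner u0 (G x)) * prim nu t.
Proof.
move=> tT i1 i2 i3; rewrite -(conv_theta cnu tT).
have i2' := integrableZl measurableT 2^-1 i2.
have i3' := integrableZl measurableT (2^-1 * `|G x| ^+ 2 - inner u0 (G x)) i3.
rewrite /conv -!RintegralZl// -RintegralD//.
apply: le_Rintegral => //; first exact: (integrableD measurableT i2' i3').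
move=> s _; rewrite !mulrA [2^-1 * nu _]mulrC [(_ - _) * nu _]mulrC -!mulrA -mulrDr.
rewrite ler_wpM2l// /g /theta; case: ifPn => sT; last first.
  by rewrite u_out// linear0 inner0l mul0r subr0 mulr0 addr0 mulr_ge0.
rewrite mul1r mulr1 addrA lerB// /U.
have := sqr_ge0 `|G (ut s) - G x|.
rewrite -inner_norm -scaleN1r innerDl !innerDr !innerZl !innerZr.
by rewrite [inner (G x) (G (ut s))]innerC !inner_norm; lra.
Qed.

Let ae_identity : {ae mu, forall t, 0 < t < T ->
  conv j (W (ut t)) t = kappa0 * g (ut t) t - conv nu (g (ut t)) t}.
Proof.
pose h t v := conv j (W v) t - (kappa0 * g v t - conv nu (g v) t).
have h0 v : {ae mu, forall t, 0 < t < T -> h t v = 0}.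
  have out t : T <= t -> (0 < t < T) = false by move=> Tt; rewrite [t < T]ltNge Tt andbF.
  have W0 t : T <= t -> W v t = 0 by move=> Tt; rewrite /W w_out ?out.
  have g0 t : T <= t -> g v t = 0.
    by move=> Tt; rewrite /g u_out ?out// linear0 inner0l /theta out// mul0r subr0.
  have := caputo_conv ck cj cnu kappaE (cW v) (cg v) W0 g0 (caputo_ug v).
  apply: filterS.
    exact: (ae_filter_ringOfSetsType mu).
  by move=> t ht tT; rewrite /h ht// subrr.
(* The dominating functions [|wt s|] and [M * phi_g s] do not involve the vector, so one null set
   serves all vectors. *)
have hc : {ae mu, forall t, 0 < t < T -> continuous (h t)}.
  have := ae_integrable_conv cnu cphi_g; have := ae_integrable_conv cj cw_norm.
  apply: filterS2; first exact: (ae_filter_ringOfSetsType mu).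
  move=> t iw ig tT; have [M M0 GM] := bound_G.
  have gB x y s : g x s - g y s = g (x - y) s.
    rewrite /g; have -> : G (x - y) = G x + (-1) *: G y by rewrite linearB scaleN1r.
    by rewrite !innerDr !innerZr; ring.
  have gM x s : `|g x s| <= M * phi_g s * `|x|.
    apply: le_trans (g_le x s) _; rewrite mulrAC mulrC ler_wpM2r//.
    by rewrite addr_ge0// mulr_ge0// theta_ge0.
  have ig' : mu.-integrable setT (fun s => (nu (t - s) * (M * phi_g s))%:E).
    have := integrableZl measurableT M ig; apply: eq_integrable => // s _.
    by rewrite /= -EFinM; congr EFin; ring.
  have [mj _ _] := cj; have [mnu _ _] := cnu.
  have WB x y s : W x s - W y s = W (x - y) s by rewrite /W linearB.
  have c1 := conv_lipschitz mj j0 mW (fun x s => W_le x s) WB iw.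
  have c2 := conv_lipschitz mnu nu0 mg gM gB ig'.
  apply: (@lipschitz_continuous _ _ _ (conv j (fun s => `|wt s|) t +
    (`|kappa0| * (M * phi_g t) + conv nu (fun s => M * phi_g s) t))) => x y.
  rewrite /h.
  rewrite (_ : _ - _ = (conv j (W x) t - conv j (W y) t) -
    (kappa0 * (g x t - g y t) - (conv nu (g x) t - conv nu (g y) t))); last by ring.
  rewrite mulrDl; apply: le_trans (ler_normB _ _) _; apply: lerD => //.
  rewrite mulrDl; apply: le_trans (ler_normB _ _) _; apply: lerD => //.
  by rewrite normrM gB -mulrA ler_wpM2l.
have := ae_eq0_caratheodory lim_u h0 hc; apply: filterS.
  exact: (ae_filter_ringOfSetsType mu).
by move=> t ht tT; apply/eqP; rewrite -subr_eq0; apply/eqP/ht.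
Qed.

Let kap := conv k j.

Let kap_ge0 t : 0 <= kap t.
Proof. by apply: Rintegral_ge0 => s _; rewrite mulr_ge0. Qed.

Let pointwise_lower t : 0 < t < T ->
  conv j (W (ut t)) t = kappa0 * g (ut t) t - conv nu (g (ut t)) t ->
  mu.-integrable setT (fun s => (nu (t - s) * g (ut t) s)%:E) ->
  mu.-integrable setT (fun s => (nu (t - s) * U s)%:E) ->
  mu.-integrable setT (fun s => (nu (t - s) * theta T s)%:E) ->
  kappa0 * U t - conv nu U t - `|u0| ^+ 2 * kap t <= 2 * conv j (W (ut t)) t.
Proof.
move=> /andP[t0 tT] -> i1 i2 i3.
have := conv_nu_le tT i1 i2 i3.
have kE := kappaE t0; have kp := kap_ge0 t; rewrite -/kap in kE.
have -> : prim nu t = kappa0 - kap t by rewrite kE; ring.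
rewrite /g /theta t0 tT/= inner_norm mul1r -/(U t).
set b := inner u0 _; set N := conv nu (fun _ => _) t; set NU := conv nu U t.
move=> hN.
(* After inserting [hN] the terms [kappa0 * b] cancel, and what remains besides [kappa0 * U t - NU]
   is [kap t * (U t - 2 * b)]; this bound and [kap t >= 0] finish. *)
have hb : 2 * b <= `|u0| ^+ 2 + U t.
  have := sqr_ge0 `|u0 - G (ut t)|.
  rewrite -inner_norm -scaleN1r innerDl !innerDr !innerZl !innerZr.
  rewrite [inner (G _) u0]innerC !inner_norm -/b /U; lra.
have := ler_wpM2r kp hb; nra.
Qed.

(** [b] is a simple function with values in [l], close to [ut] in L^2: by
    [conv_cvg_L1] the convergence conv j_n W_v -> W_v only holds for fixed [v]. *)
Variables (lam : R) (b : R -> V) (l : seq V).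
Hypotheses (lam0 : 0 < lam) (bl : forall t, b t \in l).
Hypothesis cub2 : causal (fun t => `|ut t - b t| ^+ 2).

(** The error splits as conv j (W_u - W_b) + (conv j W_b - W_b) + (W_b - W_u) with u = [ut t] and b
    = [b t] frozen. Young's inequality bounds the outer terms; in the middle one [b t] is a member
    of [l], so the sum over [l] bounds it. *)
Let pairing_error t : 0 < t < T ->
  mu.-integrable setT (fun s => (j (t - s) * `|wt s|)%:E) ->
  mu.-integrable setT (fun s => (j (t - s) * `|wt s| ^+ 2)%:E) ->
  mu.-integrable setT (fun s => (j (t - s) * theta T s)%:E) ->
  conv j (W (ut t)) t <= wt t (ut t) +
    2^-1 * (lam * conv j (fun s => `|wt s| ^+ 2) t + lam^-1 * `|ut t - b t| ^+ 2) +
    \sum_(v <- l) `|conv j (W v) t - W v t| +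
    2^-1 * (lam * `|wt t| ^+ 2 + lam^-1 * `|ut t - b t| ^+ 2).
Proof.
move=> /andP[t0 tT] i1 i2 i3; have [mj _ _] := cj.
have WB x y s : W x s - W y s = W (x - y) s by rewrite /W linearB.
have c1 := conv_lipschitz mj j0 mW (fun x s => W_le x s) WB i1 (ut t) (b t).
have c2 := conv_young lam0 (normr_ge0 (ut t - b t)) tT i1 i2 i3.
have c3 : `|conv j (W (b t)) t - W (b t) t| <= \sum_(v <- l) `|conv j (W v) t - W v t|.
  rewrite (big_rem _ (bl t))/= lerDl; exact: sumr_ge0.
have c4 : W (b t) t - wt t (ut t) <=
    2^-1 * (lam * `|wt t| ^+ 2 + lam^-1 * `|ut t - b t| ^+ 2).
  apply: (@le_trans _ _ (`|wt t| * `|ut t - b t|)).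
    rewrite -[wt t (ut t)]/(W (ut t) t) WB; apply: le_trans (ler_norm _) _.
    by rewrite distrC; exact: W_le.
  rewrite -subr_ge0 (_ : _ - _ =
    2^-1 * lam^-1 * (lam * `|wt t| - `|ut t - b t|) ^+ 2).
    apply: mulr_ge0; last exact: sqr_ge0.
    by rewrite mulr_ge0// invr_ge0 ltW.
  by field; rewrite gt_eqF.
have := ler_norm (conv j (W (ut t)) t - conv j (W (b t)) t).
have := ler_norm (conv j (W (b t)) t - W (b t) t).
lra.
Qed.

Let cwu : causal (fun t => wt t (ut t)).
Proof. exact: causal_pairing lim_u lim_w cu2 cw2. Qed.

Lemma one_kernel_le :
  conv (conv k j) U T <= `|u0| ^+ 2 * prim k T + 2 * prim (fun t => wt t (ut t)) T +
   2 * (lam * prim (fun t => `|wt t| ^+ 2) T +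
        lam^-1 * prim (fun t => `|ut t - b t| ^+ 2) T +
        \sum_(v <- l) prim (fun t => `|conv j (W v) t - W v t|) T).
Proof.
have ckap : causal kap by exact: causal_conv.
have cjw2 := causal_conv cj cw2; have cnuU := causal_conv cnu cU.
have csum (s : seq V) : causal (fun t => \sum_(v <- s) `|conv j (W v) t - W v t|) /\
    prim (fun t => \sum_(v <- s) `|conv j (W v) t - W v t|) T =
    \sum_(v <- s) prim (fun t => `|conv j (W v) t - W v t|) T.
  elim: s => [|v s [ih1 ih2]].
    under eq_fun do rewrite big_nil; rewrite big_nil.
    split; last by rewrite /prim /Rintegral integral0.
    by split => // x; exact: integrable0.
  have cv : causal (fun t => `|conv j (W v) t - W v t|).
    by apply: causal_norm; apply: causalB => //; exact: causal_conv.
  under eq_fun do rewrite big_cons; rewrite big_cons.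
  by split; [exact: causalD|rewrite primD// ih2].
have [csl psl] := csum l.
pose L t := kappa0 * U t - conv nu U t - `|u0| ^+ 2 * kap t.
pose r1 t := 2 * wt t (ut t).
pose r2 t := lam * conv j (fun s => `|wt s| ^+ 2) t.
pose r3 t := 2 * lam^-1 * `|ut t - b t| ^+ 2.
pose r4 t := 2 * \sum_(v <- l) `|conv j (W v) t - W v t|.
pose r5 t := lam * `|wt t| ^+ 2.
have cL : causal L.
  by apply: causalB; [apply: causalB => //|]; exact: causalZ.
have cr1 : causal r1 by exact: causalZ.
have cr2 : causal r2 by exact: causalZ.
have cr3 : causal r3 by exact: causalZ.
have cr4 : causal r4 by exact: causalZ.
have cr5 : causal r5 by exact: causalZ.
have cr12 := causalD cr1 cr2.
have cr123 := causalD cr12 cr3.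
have cr1234 := causalD cr123 cr4.
have cr := causalD cr1234 cr5.
have ale : {ae mu, forall t, t < T -> L t <= r1 t + r2 t + r3 t + r4 t + r5 t}.
  have e1 := ae_and (ae_integrable_conv cj cw_norm) (ae_integrable_conv cj cw2).
  have e2 := ae_and (ae_integrable_conv cnu cphi_g) (ae_integrable_conv cnu cU).
  have e3 := ae_and (ae_integrable_conv cj (causal_theta T))
    (ae_integrable_conv cnu (causal_theta T)).
  have := ae_and (ae_and e1 e2) (ae_and e3 ae_identity).
  apply: filterS; first exact: (ae_filter_ringOfSetsType mu).
  move=> t [[[iw iw2] [ig iU]] [[ijt int] id]] tT.
  have [t0|t0] := leP t 0.
    have -> : L t = 0.
      have [_ k0' _] := ckap; have [_ c0' _] := cnuU; have [_ U0' _] := cU.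
      by rewrite /L U0'// c0'// k0'// !mulr0 !subr0.
    have r10 : r1 t = 0 by have [_ -> //] := cr1.
    have r20 : r2 t = 0 by have [_ -> //] := cr2.
    rewrite r10 r20 !add0r !addr_ge0//.
    - by rewrite /r3 !mulr_ge0// ?invr_ge0 ?exprn_ge0// ltW.
    - by rewrite /r4 mulr_ge0// sumr_ge0.
    - by rewrite /r5 mulr_ge0 ?exprn_ge0// ltW.
  have tT' : 0 < t < T by rewrite t0.
  have ig' : mu.-integrable setT (fun s => (nu (t - s) * g (ut t) s)%:E).
    have := integrableZr measurableT `|G (ut t)| ig; apply: le_integrable => //.
      apply/measurable_EFinP; apply: measurable_funM; last exact: mg.
      have [mnu _ _] := cnu.
      by apply: (measurableT_comp mnu); exact: measurable_funB.
    move=> s _ /=; rewrite lee_fin normrM (ger0_norm (nu0 _)).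
    by rewrite (le_trans _ (ler_norm _))// -mulrA ler_wpM2l.
  have h1 := pointwise_lower tT' (id tT') ig' iU int.
  have h2 := pairing_error tT' iw iw2 ijt.
  apply: (le_trans h1); rewrite /r1 /r2 /r3 /r4 /r5.
  by move: h2; lra.
(* Integrating [L] restores the regularised kernel: by [conv_split],
   [kappa0 * prim U T - prim (conv nu U) T] is [conv (conv k j) U T]. *)
have := le_prim_ae cL cr ale.
rewrite primB//; last 2 first.
- by apply: causalB => //; exact: causalZ.
- exact: causalZ.
rewrite primB//; last exact: causalZ.
rewrite (primZ _ _ cU) (primZ _ _ ckap) -(conv_split ck cj cnu kappaE)//.
rewrite (primD _ cr1234 cr5) (primD _ cr123 cr4) (primD _ cr12 cr3) (primD _ cr1 cr2).
rewrite (primZ _ _ cwu) (primZ _ _ cjw2) (primZ _ _ cub2) (primZ _ _ csl) (primZ _ _ cw2).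
rewrite psl.
have jw2 : prim (conv j (fun s => `|wt s| ^+ 2)) T <= prim (fun s => `|wt s| ^+ 2) T.
  rewrite prim_conv// -[leRHS]mul1r; apply: conv_le_prim => //.
  - exact: causal_prim.
  - by move=> x xT; rewrite prim_ge0//= prim_j_le.
have kk : prim kap T <= prim k T.
  have [mk _ _] := ck; have [mj _ _] := cj.
  rewrite /kap convC// prim_conv// -[leRHS]mul1r; apply: conv_le_prim => //.
    exact: causal_prim.
  by move=> x xT; rewrite prim_ge0//= prim_j_le.
have := ler_wpM2l (ltW lam0) jw2.
have := ler_wpM2l (sqr_ge0 `|u0|) kk.
lra.
Qed.

End one_kernel.

Section kernel_sequence.
Variables (j nu : nat -> R -> R) (kappa0 : nat -> R).
Hypothesis cj : forall n, causal (j n) /\ forall t, 0 <= j n t.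
Hypothesis cnu : forall n, causal (nu n) /\ forall t, 0 <= nu n t.
Hypothesis kappaE : forall n t, 0 < t ->
  conv k (j n) t = kappa0 n - prim (nu n) t.
Hypothesis jT : forall n, prim (j n) T = 1.
Hypothesis k_prim_le : forall n t, 0 < t -> k t * prim (j n) t <= conv k (j n) t.
Hypothesis cvgj : forall t, 0 < t -> t <= T -> prim (j n) t @[n --> \oo] --> (1 : R).

Let C := `|u0| ^+ 2 * prim k T + 2 * prim (fun t => wt t (ut t)) T.

Let csu n : causal (fun t => `|ut t - su n t| ^+ 2) /\
  (forall t, `|ut t - su n t| ^+ 2 <= 9 * `|ut t| ^+ 2).
Proof.
(* 9 is the square of 1 + 2, the 2 coming from [su_le]. *)
have le9 t : `|ut t - su n t| ^+ 2 <= 9 * `|ut t| ^+ 2.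
  have h : `|ut t - su n t| <= 3 * `|ut t|.
    by apply: le_trans (ler_normB _ _) _; have := su_le n t; lra.
  have := normr_ge0 (ut t - su n t); nra.
split=> //; apply: (le_causal (p := fun t => 9 * `|ut t| ^+ 2)).
- apply: measurable_funX.
  apply: (measurable_caratheodory (h := fun t v => `|v - su n t|) lim_u).
    move=> x; apply: (measurable_comp_simple (h := fun t y => `|x - y|)) => //.
    by have [ss _] := lim_u.
  move=> t; apply: (@lipschitz_continuous _ _ _ 1) => x y.
  apply: le_trans (ler_dist_dist _ _) _.
  by rewrite mul1r opprB addrA subrK.
- exact: causalZ.
- by move=> t; rewrite ger0_norm ?exprn_ge0.
Qed.

Let near_le e : 0 < e -> \forall n \near \oo, conv (conv k (j n)) U T <= C + e.
Proof.
move=> e0; set w2 := prim (fun t => `|wt t| ^+ 2) T.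
have w20 : 0 <= w2 by apply: prim_ge0.
(* The order of choices matters: [lam] makes the term in [w2] at most e/3, then [m] beats the factor
   [lam^-1], and only then, with the finite list [l] fixed by [m], is [n] taken large. The summand 1
   covers [w2 = 0]. *)
pose lam := e / (6 * (w2 + 1)).
have lam0 : 0 < lam by rewrite divr_gt0//; lra.
have w21 : 0 < w2 + 1 by lra.
have lw : 2 * (lam * w2) <= e / 3.
  rewrite (_ : _ * _ = e / 3 * (w2 / (w2 + 1))); last first.
    by rewrite /lam; field; rewrite gt_eqF.
  by rewrite ler_piMr ?ler_pdivrMr//; lra.
have e6 : 0 < lam * e / 6 by rewrite divr_gt0// mulr_gt0.
have [m hm] : exists m, prim (fun t => `|ut t - su m t| ^+ 2) T <= lam * e / 6.
  have h : prim (fun t => `|ut t - su m t| ^+ 2) T @[m --> \oo] --> prim (cst (0:R)) T.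
    apply: (@cvg_prim _ _ _ (fun t => 9 * `|ut t| ^+ 2)).
    - by move=> n; exact: (csu n).1.
    - by split => // x; exact: integrable0.
    - exact: causalZ.
    - apply: aeW => t _.
      have [_ /(_ t) h] := lim_u.
      have {}h : `|ut t - su n t| @[n --> \oo] --> (0 : R).
        rewrite -(@normr0 R V) -(subrr (ut t)); apply: cvg_norm.
        by apply: cvgB => //; exact: cvg_cst.
      by have := cvgM h h; rewrite mulr0; exact.
    - by move=> n t _; rewrite ger0_norm ?exprn_ge0// (csu n).2.
  rewrite (_ : prim (cst 0) T = 0) in h; last by rewrite /prim /Rintegral integral0.
  move/cvgr0Pnorm_le : h => /(_ _ e6) h.
  near \oo => m; exists m; apply: le_trans (ler_norm _) _.
  by near: m.
have [l lE] : exists l : seq V, forall t, su m t \in l.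
  have [ss _] := lim_u; have [/finite_seqP[l lE] _] := ss m.
  by exists l => t; have : range (su m) (su m t) by []; rewrite lE.
have hS : \sum_(v <- l) prim (fun t => `|conv (j n) (W v) t - W v t|) T
    @[n --> \oo] --> (0 : R).
  elim: (l) => [|v l' ih].
    by under eq_fun do rewrite big_nil; exact: cvg_cst.
  under eq_fun do rewrite big_cons.
  have WT t : T <= t -> W v t = 0.
    by move=> Tt; rewrite /W w_out// [t < T]ltNge Tt andbF.
  have cv := conv_cvg_L1 (fun n => (cj n).1) (fun n => (cj n).2) jT cvgj T_gt0 (cW v) WT.
  by have := cvgD cv ih; rewrite addr0; exact.
have e30 : 0 < e / 6 by lra.
move/cvgr0Pnorm_le : hS => /(_ _ e30); apply: filterS => n hn.
have [cjn j0n] := cj n; have [cnun nu0n] := cnu n.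
have := one_kernel_le cjn j0n (jT n) cnun nu0n (kappaE n) lam0 lE (csu m).1.
have := le_trans (ler_norm _) hn.
have : 2 * (lam^-1 * prim (fun t => `|ut t - su m t| ^+ 2) T) <= e / 3.
  rewrite (_ : e / 3 = 2 * (e / 6)); last by field.
  by rewrite ler_pM2l// ler_pdivrMl// mulrA.
rewrite -/w2 /C; lra.
Unshelve. all: by end_near. Qed.

Let lower_bound n : (\int[mu]_s (k (T - s) * prim (j n) (T - s) * U s)%:E <=
  (conv (conv k (j n)) U T)%:E)%E.
Proof.
have [cjn j0n] := cj n; have [cnun nu0n] := cnu n.
have ckj := causal_conv ck cjn; have [mkj kj0 _] := ckj.
have kj_ge0 t : 0 <= conv k (j n) t.
  by apply: Rintegral_ge0 => s _; rewrite mulr_ge0.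
have [mU U0 _] := cU; have [mk k0' _] := ck.
(* The regularised kernel is bounded by [kappa0 n], so the real integral [conv] is not a default
   value of [fine]. *)
have ib : mu.-integrable `]-oo, T] (EFin \o (fun s => conv k (j n) (T - s) * U s)).
  apply: (@integrable_conv_bounded _ _ _ `|kappa0 n|) => // x _.
  have [x0|x0] := leP x 0; first by rewrite kj0// normr0.
  rewrite ger0_norm//; apply: le_trans (ler_norm _); rewrite kappaE//.
  by rewrite gerBl prim_ge0.
rewrite conv_itv// /Rintegral fineK; last exact: integrable_fin_num.
have UT s : T < s -> U s = 0.
  by move=> Ts; rewrite /U u_out ?linear0 ?normr0 ?expr0n// [s < T]ltNge ltW// andbF.
rewrite [leRHS]integral_mkcond; apply: ge0_le_integral_nonmeasurable => s _.
  by rewrite lee_fin !mulr_ge0 ?prim_ge0.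
rewrite patchE mem_setE in_itv/=; case: ifPn => sT; last first.
  by rewrite UT ?mulr0// ltNge.
rewrite lee_fin ler_wpM2r//.
have [Ts|Ts] := leP (T - s) 0; first by rewrite k0'// mul0r.
exact: k_prim_le.
Qed.

Lemma fractional_energy_estimate :
  (\int[mu]_s (k (T - s) * U s)%:E <= C%:E)%E.
Proof.
have [mU U0 _] := cU; have [mk k0' _] := ck.
pose f n s : \bar R := (k (T - s) * prim (j n) (T - s) * U s)%:E.
have mT (p : R -> R) : measurable_fun setT p ->
    measurable_fun setT (fun s : R => p (T - s)).
  by move=> mp; apply: (measurableT_comp mp); exact: measurable_funB.
have mf n : measurable_fun setT (f n).
  apply/measurable_EFinP; apply: measurable_funM => //.
  apply: measurable_funM; apply: mT => //.
  by have [] := causal_prim (cj n).1.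
have f0 n s : setT s -> (0 <= f n s)%E.
  by move=> _; rewrite lee_fin !mulr_ge0// prim_ge0// => t; exact: (cj n).2.
(* Inside (0, T) the mass [prim (j n) (T - s)] tends to 1; elsewhere [U s = 0]. *)
have fE s : limn_einf (f^~ s) = (k (T - s) * U s)%:E.
  suff h : f n s @[n --> \oo] --> (k (T - s) * U s)%:E.
    by have [-> _] := cvg_limn_einf_sup h.
  apply: cvg_EFin; first exact: nearW.
  have [sT|sT] := boolP (0 < s < T); last first.
    apply: cvg_near_cst; apply: nearW => n /=.
    by rewrite /U u_out// linear0 normr0 expr0n !mulr0.
  have /andP[s0 sT'] := sT.
  have -> : k (T - s) * U s = k (T - s) * 1 * U s by rewrite mulr1.
  apply: cvgM; last exact: cvg_cst.
  apply: cvgM; first exact: cvg_cst.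
  by apply: cvgj; lra.
have := fatou mu measurableT mf f0.
rewrite (_ : (\int[mu]_x limn_einf (f^~ x))%E =
    \int[mu]_s (k (T - s) * U s)%:E)%E; last first.
  by apply: eq_integral => s _; exact: fE.
move=> /le_trans; apply; apply/lee_addgt0Pr => e e0.
rewrite limn_einf_lim; apply: lime_le; first exact: is_cvg_einfs.
have := near_le e0; apply: filterS => n hn.
apply: (@le_trans _ _ (\int[mu]_s f n s)%E).
  by apply: ereal_inf_lbound; exists n => /=.
by apply: (le_trans (lower_bound n)); rewrite -EFinD lee_fin.
Qed.

End kernel_sequence.

End energy_estimate.

(** * Null sets and scalar factors under possibly infinite integrals *)

Section null_sets.
Context {R : realType}.
Local Notation mu := (@lebesgue_measure R).

Lemma eq_integral_off_null (D B : set R) (f g : R -> \bar R) : measurable B ->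
  mu B = 0%E -> (forall x, (D `\` B) x -> f x = g x) ->
  (\int[mu]_(x in D) f x = \int[mu]_(x in D) g x)%E.
Proof.
move=> mB B0 fg; rewrite (@integral_setD_null _ _ _ mu D B f mB B0).
rewrite (@integral_setD_null _ _ _ mu D B g mB B0).
by apply: eq_integral => x; rewrite inE; exact: fg.
Qed.

Lemma ge0_Rintegralr_scale (D : set R) r (f : R -> R) : measurable D ->
  measurable_fun D f -> 0 <= r ->
  r * \int[mu]_(x in D) f x = \int[mu]_(x in D) (r * f x).
Proof.
move=> mD mf r0; have mf' : measurable_fun D (EFin \o f) by exact/measurable_EFinP.
rewrite /Rintegral.
rewrite -[X in _ = fine (integral _ _ X)]/(fun x => r%:E * (EFin \o f) x)%E.
rewrite [in RHS]integralE (ge0_funeposM _ r0) (ge0_funenegM _ r0) integralE.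
rewrite !ge0_integralZl_EFin//; first last.
- exact: measurable_funepos.
- exact: measurable_funeneg.
set a := (\int[mu]_(x in D) _)%E; set b := (\int[mu]_(x in D) _)%E.
have a0 : (0 <= a)%E by exact: integral_ge0.
have b0 : (0 <= b)%E by exact: integral_ge0.
have [->|rn0] := eqVneq r 0; first by rewrite mul0r !mul0e sube0.
have r_gt0 : 0 < r by rewrite lt_neqAle eq_sym rn0.
move: a b a0 b0 => [a| |] [b| |]//= _ _; rewrite ?mulrBr// gt0_muley ?lte_fin//= ?mulr0//.
Qed.

End null_sets.

(** * The energy norm and its dual norm *)

Section energy.
Context {R : realType} {V H : hilbertType R}.
Variable F : {linear V -> dual V}.
Hypothesis F_cont : continuous F.
Local Notation N := (energy_norm F).

Lemma energy_bounded : exists2 M, 0 < M & forall v, F v v <= M * `|v| ^+ 2.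
Proof.
have /linear_boundedP/pinfty_ex_gt0[M M0 FM] :=
  continuous_linear_bounded 0 (@F_cont 0).
exists M => // v; apply: le_trans (ler_norm _) _; apply: le_trans (dual_le _ _) _.
by rewrite expr2 mulrA ler_wpM2r.
Qed.

Variable a : R.
Hypothesis a_gt0 : 0 < a.
Hypothesis F_coer : forall v, a * `|v| ^+ 2 <= F v v.

Lemma energy_ge0 v : 0 <= F v v.
Proof. by apply: le_trans (F_coer v); rewrite mulr_ge0 ?sqr_ge0 ?ltW. Qed.

Lemma sqr_energy_norm v : N v ^+ 2 = F v v.
Proof. by rewrite sqr_sqrtr// energy_ge0. Qed.

Lemma energy_normZ r v : N (r *: v) = `|r| * N v.
Proof.
rewrite /energy_norm (_ : F (r *: v) (r *: v) = r ^+ 2 * F v v); last first.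
  have -> : F (r *: v) = r *: F v by exact: linearZ.
  by rewrite dualZ linearZ expr2 -mulrA.
by rewrite sqrtrM ?sqr_ge0// sqrtr_sqr.
Qed.

Lemma energy_norm_gt0 v : v != 0 -> 0 < N v.
Proof.
move=> v0; rewrite sqrtr_gt0; apply: lt_le_trans (F_coer v).
by rewrite mulr_gt0// exprn_gt0// normr_gt0.
Qed.

(** [sup] is meaningful only on bounded sets; coercivity puts the energy ball inside the ball of
    radius [a^(-1/2)]. *)
Lemma energy_dual_has_ubound (l : dual V) :
  has_ubound [set `|l v| | v in [set v | N v <= 1]].
Proof.
exists (`|l| * Num.sqrt a^-1) => _ [w Nw <-]; apply: le_trans (dual_le _ _) _.
rewrite ler_wpM2l// -(normr_id w) -sqrtr_sqr ler_sqrt ?invr_ge0 ?(ltW a_gt0)//.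
rewrite -[a^-1]mulr1 ler_pdivlMl//; apply: le_trans (F_coer w) _.
by rewrite -sqr_energy_norm expr_le1// sqrtr_ge0.
Qed.

Lemma energy_dual_ge0 (l : dual V) : 0 <= dual_norm N l.
Proof.
apply: (ub_le_sup (energy_dual_has_ubound l)); exists 0; last by rewrite linear0 normr0.
by rewrite /= -(scale0r 0) energy_normZ normr0 mul0r.
Qed.

Lemma energy_dual_le (l : dual V) v : `|l v| <= dual_norm N l * N v.
Proof.
have [->|v0] := eqVneq v 0.
  by rewrite linear0 normr0 mulr_ge0 ?energy_dual_ge0// sqrtr_ge0.
have Nv := energy_norm_gt0 v0.
rewrite -ler_pdivrMr//; apply: ub_le_sup; first exact: energy_dual_has_ubound.
exists ((N v)^-1 *: v).
  by rewrite /= energy_normZ gtr0_norm ?invr_gt0// mulVf// gt_eqF.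
by rewrite linearZ/= normrM gtr0_norm ?invr_gt0// mulrC.
Qed.

(** The energy norm is at most [sqrt M] on the unit ball of [V]. Square-integrability in the energy
    dual norm thus passes to the operator norm. *)
Lemma norm_le_energy_dual M (l : dual V) : 0 < M ->
  (forall v, F v v <= M * `|v| ^+ 2) -> M^-1 * `|l| ^+ 2 <= dual_norm N l ^+ 2.
Proof.
move=> M0 FM; rewrite ler_pdivrMl// -[M]sqr_sqrtr ?(ltW M0)// -exprMn.
have h : 0 <= Num.sqrt M * dual_norm N l by rewrite mulr_ge0 ?sqrtr_ge0 ?energy_dual_ge0.
rewrite ler_sqr ?nnegrE//; apply: ge_sup.
  by exists `|l 0|, 0 => //=; rewrite normr0.
move=> _ [v v1 <-]; apply: le_trans (energy_dual_le l v) _.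
rewrite mulrC ler_wpM2r ?energy_dual_ge0// ler_sqrt ?(ltW M0)//.
by apply: le_trans (FM v) _; rewrite ler_piMr ?(ltW M0)// expr_le1.
Qed.

Lemma le_energy_dual (l : dual V) v : 2 * (l v - F v v) + F v v <= dual_norm N l ^+ 2.
Proof.
have := le_trans (ler_norm _) (energy_dual_le l v).
rewrite -sqr_energy_norm; have := sqr_ge0 (dual_norm N l - N v).
by rewrite sqrrB mulr2n; lra.
Qed.

End energy.

Section L2.
Context {R : realType} {X : normedModType R}.
Local Notation mu := (@lebesgue_measure R).

(** [N (f t)] may fail to be measurable, but the measurable function [K * |ft t|^2] lies below its
    square, and monotonicity of the integral gives finiteness. *)
Lemma causal_sqr_L2 (N : X -> R) (T K : R) (B : set R) (f : R -> X) (s : nat -> R -> X) :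
  let ft t := if t \in `]0, T[%classic `\` B then f t else 0 in
  0 < K -> (forall x, K * `|x| ^+ 2 <= N x ^+ 2) -> simple_limit s ft ->
  (sqr_L2norm T N f < +oo)%E -> causal (fun t => `|ft t| ^+ 2).
Proof.
move=> ft K0 KN sft fN.
have mft : measurable_fun setT (fun t => `|ft t| ^+ 2).
  apply: measurable_funX; apply: (measurable_simple_limit (p := Num.norm) sft).
  by move=> x; exact: cvg_norm.
have h : causal (fun t => K * `|ft t| ^+ 2).
  split.
  - exact: measurable_funM.
  - move=> x x0; rewrite /ft ifF ?normr0 ?expr0n ?mulr0//; apply/negbTE.
    by rewrite notin_setE => -[/=]; rewrite in_itv/= ltNge x0.
  - move=> x; apply: (@integrableS _ _ _ mu setT _ _ measurableT _ (@subsetT _ _)) => //.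
    apply/integrableP; split; first by apply/measurable_EFinP; exact: measurable_funM.
    apply: le_lt_trans fN; rewrite /sqr_L2norm [leRHS]integral_mkcond.
    apply: ge0_le_integral_nonmeasurable => // t _.
    rewrite patchE /ft /=; case: (boolP (t \in _ `\` _)) => [|_].
      rewrite inE => -[tT _]; rewrite (mem_set tT) lee_fin ger0_norm ?KN//.
      by rewrite mulr_ge0 ?(ltW K0)// sqr_ge0.
    rewrite normr0 expr0n mulr0 normr0; case: ifP => // _.
    by rewrite lee_fin sqr_ge0.
have := causalZ K^-1 h; congr causal; apply/funext => t.
by rewrite mulrA mulVf ?mul1r// gt_eqF.
Qed.

End L2.

(** * Fractional integrals as convolutions with the causal kernel *)

Section fractional_kernel.
Context {R : realType}.
Local Notation mu := (@lebesgue_measure R).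
Implicit Types (gamma T t r : R) (phi h : R -> R).

Lemma Gamma_ge0 (s : R) : 0 <= Gamma s.
Proof. by apply: Rintegral_ge0 => t _; rewrite mulr_ge0 ?powR_ge0 ?expR_ge0. Qed.

Definition frac_kernel gamma t : R := (Gamma (1 - gamma))^-1 * pow (- gamma) t.

Lemma frac_kernel_ge0 gamma t : 0 <= frac_kernel gamma t.
Proof. by rewrite mulr_ge0 ?pow_ge0// invr_ge0 Gamma_ge0. Qed.

Lemma causal_frac_kernel gamma : gamma < 1 -> causal (frac_kernel gamma).
Proof. by move=> g1; apply: causalZ; apply: causal_pow; rewrite ltrN2. Qed.

Let powE gamma t : 0 < t -> t `^ (1 - gamma - 1) = pow (- gamma) t.
Proof. by move=> t0; rewrite /pow t0 (_ : 1 - gamma - 1 = - gamma)//; lra. Qed.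

Lemma fracint_rightE gamma T phi : continuous phi ->
  fracint_right (1 - gamma) T phi =
  fun r => \int[mu]_(t in `]r, T[) (frac_kernel gamma (t - r) * phi t).
Proof.
move=> cphi; apply/funext => r; rewrite /fracint_right.
have mi : measurable (`]r, T[%classic : set R) by exact: measurable_itv.
transitivity ((Gamma (1 - gamma))^-1 *
    \int[mu]_(t in `]r, T[) (pow (- gamma) (t - r) * phi t)).
  congr (_ * _); apply: eq_Rintegral => t; rewrite inE/= in_itv/= => /andP[rt _].
  by rewrite powE// subr_gt0.
rewrite ge0_Rintegralr_scale//; last by rewrite invr_ge0 Gamma_ge0.
  by apply: eq_Rintegral => t _; rewrite mulrA.
apply: measurable_funTS; apply: measurable_funM.
  apply: (measurableT_comp (measurable_pow (- gamma))).
  exact: measurable_funB.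
exact: continuous_measurable_fun.
Qed.

Lemma fracintE gamma T h hB (B : set R) : measurable B -> mu B = 0%E ->
  (forall t, hB t = if t \in `]0, T[%classic `\` B then h t else 0) ->
  (forall t, 0 <= h t) -> measurable_fun setT hB ->
  fracint (1 - gamma) h T = (\int[mu]_s (frac_kernel gamma (T - s) * hB s)%:E)%E.
Proof.
move=> mB B0 hBE h0 mhB; rewrite /fracint.
have mp : measurable_fun setT (fun s : R => pow (- gamma) (T - s) * hB s).
  apply: measurable_funM => //; apply: (measurableT_comp (measurable_pow (- gamma))).
  exact: measurable_funB.
have hB0 t : 0 <= hB t by rewrite hBE; case: ifP.
rewrite (@ge0_integral_setD_null _ _ _ mu _ B _ mB B0); last first.
  by move=> t _; rewrite lee_fin mulr_ge0// powR_ge0.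
transitivity ((Gamma (1 - gamma))^-1%:E * \int[mu]_s (pow (- gamma) (T - s) * hB s)%:E)%E.
  congr (_ * _)%E; rewrite integral_mkcond; apply: eq_integral => t _.
  rewrite patchE hBE; case: (boolP (t \in _ `\` _)) => [|_]; last by rewrite mulr0.
  rewrite inE => -[+ _]; rewrite /= in_itv/= => /andP[_ tT].
  by rewrite powE// subr_gt0.
rewrite -ge0_integralZl_EFin//.
- by apply: eq_integral => t _; rewrite -EFinM mulrA.
- by move=> t _; rewrite lee_fin mulr_ge0// pow_ge0.
- exact/measurable_EFinP.
- by rewrite invr_ge0 Gamma_ge0.
Qed.

Lemma fracint_cst gamma T r : gamma < 1 -> 0 <= r ->
  fracint (1 - gamma) (fun=> r) T = (r * prim (frac_kernel gamma) T)%:E.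
Proof.
move=> g1 r0; have ck := causal_frac_kernel g1; have [mk k0 ik] := ck.
rewrite (@fracintE gamma T (fun=> r) (fun t => r * theta T t) set0)//; last 2 first.
- move=> t; rewrite setD0 mem_setE in_itv /theta/=.
  by case: ifP; rewrite ?mulr1 ?mulr0.
- by apply: measurable_funM => //; have [] := causal_theta T.
have mf : measurable_fun setT
    (fun s : R => (frac_kernel gamma (T - s) * (r * theta T s))%:E).
  apply/measurable_EFinP; apply: measurable_funM.
    by apply: (measurableT_comp mk); exact: measurable_funB.
  by apply: measurable_funM => //; have [] := causal_theta T.
rewrite (integral_reflect T)// -primZ//.
have irk : mu.-integrable `]-oo, T] (EFin \o (fun x => r * frac_kernel gamma x)).
  by have [_ _] := causalZ r ck; exact.
rewrite /prim /Rintegral fineK; last exact: integrable_fin_num.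
(* The two integrands may differ at [t = T], where [theta T 0 = 0]. *)
rewrite (@eq_integral_off_null _ `]-oo, T] [set T] (fun x => (r * frac_kernel gamma x)%:E)
  (fun t => (frac_kernel gamma (T - (T - t)) * (r * theta T (T - t)))%:E)).
- rewrite [RHS]integral_mkcond; apply: eq_integral => t _.
  rewrite patchE mem_setE in_itv/=; case: ifPn => // tT.
  by rewrite /theta subr_gt0 (negPf (_ : ~~ (t < T))) ?andFb ?mulr0// -leNgt ltW// ltNge.
- exact: measurable_set1.
- exact: lebesgue_measure_set1.
- move=> t [+ /= tT]; rewrite /= in_itv/= => tT'.
  have {}tT : t < T by rewrite lt_neqAle tT' andbT; exact/eqP.
  rewrite subKr; have [t0|t0] := leP t 0; first by rewrite k0// mulr0 mul0r.
  by rewrite /theta subr_gt0 tT/= (_ : T - t < T) ?mulr1 1?mulrC// ltrBlDr ltrDl.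
Qed.

End fractional_kernel.

(** * Reduction to everywhere-defined representatives and conclusion *)

Theorem corollary3p8 (R : realType) (V H : hilbertType R) (G : gelfand V H)
    (F : {linear V -> dual V}) (F_cont : continuous F) (F_coer : coercive F)
    (T : R) (T_gt0 : 0 < T)
    (gamma : R) (gamma_gt0 : 0 < gamma) (gamma_lt1 : gamma < 1)
    (f : R -> dual V) (f_L2 : in_L2 T (dual_norm (energy_norm F)) f)
    (u0 : H) (u : R -> V) (u_sol : is_solution G F gamma T f u0 u) :
  (fracint (1 - gamma)%R (fun t => `|G (u t)| ^+ 2)%R T
     + sqr_L2norm T (energy_norm F) u
   <= fracint (1 - gamma)%R (fun=> `|u0| ^+ 2)%R T
     + sqr_L2norm T (dual_norm (energy_norm F)) f)%E.
Proof.
have [a a0 Fa] := F_coer; have [M M0 FM] := energy_bounded F_cont.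
have [[mu_u u2] [w [[mw w2] cap [E [mE E0 eqE]]]]] := u_sol.
have mD : measurable (`]0, T[%classic : set R) by exact: measurable_itv.
have [Au [mAu Au0 hu]] := strongly_measurable_simple_limit mD mu_u.
have [Aw [mAw Aw0 hw]] := strongly_measurable_simple_limit mD mw.
(* One null set for three defects: the approximations of [u], those of [w], and the equation
   itself. *)
pose B := Au `|` Aw `|` E.
have mB : measurable B by apply: measurableU => //; exact: measurableU.
have B0 : (@lebesgue_measure R) B = 0%E.
  by rewrite measureU0 //; [rewrite measureU0|exact: measurableU].
have [su lim_u su_le] := hu B mB (fun t h => or_introl (or_introl h)).
have [sw lim_w _] := hw B mB (fun t h => or_introl (or_intror h)).
set ut := (fun t => if t \in _ then u t else 0) in lim_u su_le.
set wt := (fun t => if t \in _ then w t else 0) in lim_w.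
have out t : ~~ (0 < t < T) -> t \in `]0, T[%classic `\` B = false.
  by move=> tT; apply/negbTE; rewrite notin_setE => -[/=]; rewrite in_itv/= (negPf tT).
have inD t : (`]0, T[%classic `\` B) t -> t \in `]0, T[%classic `\` B.
  by move=> h; rewrite inE.
have u_out t : ~~ (0 < t < T) -> ut t = 0 by move=> /out h; rewrite /ut h.
have w_out t : ~~ (0 < t < T) -> wt t = 0 by move=> /out h; rewrite /wt h.
have cu2 : causal (fun t => `|ut t| ^+ 2).
  by apply: (causal_sqr_L2 a0 _ lim_u u2) => v; rewrite (sqr_energy_norm a0).
have cw2 : causal (fun t => `|wt t| ^+ 2).
  apply: (causal_sqr_L2 (K := M^-1) _ _ lim_w w2); first by rewrite invr_gt0.
  by move=> l; exact: (norm_le_energy_dual a0).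
have [ck k0] := (causal_frac_kernel gamma_lt1, @frac_kernel_ge0 R gamma).
have caputo (v : V) (phi : R -> R) : test_function T phi ->
    \int[lebesgue_measure]_(t in `]0, T[) (wt t v * phi t) =
    - \int[lebesgue_measure]_(t in `]0, T[)
        ((inner (G (ut t)) (G v) - theta T t * inner u0 (G v)) *
         derive1 (fun r => \int[lebesgue_measure]_(t0 in `]r, T[)
           (frac_kernel gamma (t0 - r) * phi t0)) t).
  move=> tphi; have [dphi _ _] := tphi.
  have cphi : continuous phi.
    by move=> t; apply: differentiable_continuous; exact/derivable1_diffP.
  have := cap v phi tphi; rewrite /dist_derive fracint_rightE//= => capE.
  transitivity (\int[lebesgue_measure]_(t in `]0, T[) (w t v * phi t)).
    congr fine; apply: (eq_integral_off_null mB B0) => t h.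
    by rewrite /wt (inD _ h).
  rewrite capE; congr (- fine _); apply: (eq_integral_off_null mB B0) => t h.
  by rewrite /ut (inD _ h) /theta; case: h => /=; rewrite in_itv/= => -> _; rewrite mul1r.
have g_ge0 : 0 <= (Gamma (1 - gamma))^-1 by rewrite invr_ge0 Gamma_ge0.
have [j [nu [kappa0 [cj cnu kE jT cvgj]]]] :=
  yosida_kernels gamma_gt0 gamma_lt1 g_ge0 T_gt0.
have := fractional_energy_estimate T_gt0 ck k0 lim_u lim_w u_out w_out cu2 cw2
  su_le caputo cj cnu kE (fun n => (jT n).1) (fun n => (jT n).2) cvgj.
have UE : fracint (1 - gamma) (fun t => `|G (u t)| ^+ 2) T =
    (\int[lebesgue_measure]_s (frac_kernel gamma (T - s) * `|G (ut s)| ^+ 2)%:E)%E.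
  apply: (@fracintE R gamma T (fun t => `|G (u t)| ^+ 2)
    (fun t => `|G (ut t)| ^+ 2) B mB B0) => //.
    by move=> t; rewrite /ut; case: ifP => // _; rewrite linear0 normr0 expr0n.
  apply: measurable_funX.
  apply: (measurable_simple_limit (p := fun x => `|G x|) lim_u) => x.
  by apply: cvg_norm; exact: (@emb_continuous _ _ _ G x).
rewrite -UE.
have Fut t : 0 <= F (ut t) (ut t) by exact: (energy_ge0 a0).
have cFu : causal (fun t => F (ut t) (ut t)).
  apply: (le_causal (p := fun t => M * `|ut t| ^+ 2)).
  - apply: (measurable_caratheodory (h := fun t v => F (ut t) v) lim_u).
      move=> v; apply: (measurable_simple_limit (p := fun x => F x v) lim_u).
      move=> x; apply: (@cvg_comp _ _ _ F (fun l : dual V => l v) _ _ _ (F_cont x)).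
      exact: dual_eval_continuous.
    by move=> t; exact: dual_continuous.
  - exact: causalZ.
  - by move=> t; rewrite ger0_norm.
have cwu := causal_pairing lim_u lim_w cu2 cw2.
have cq := causalD (causalZ 2 cwu) cFu.
have prim_fin p : causal p ->
    (prim p T)%:E = (\int[lebesgue_measure]_(t in `]-oo, T]) (p t)%:E)%E.
  by move=> [_ _ ip]; rewrite /prim /Rintegral fineK//; apply: integrable_fin_num.
have uE : sqr_L2norm T (energy_norm F) u = (prim (fun t => F (ut t) (ut t)) T)%:E.
  rewrite prim_fin// /sqr_L2norm.
  rewrite (@ge0_integral_setD_null _ _ _ lebesgue_measure _ B _ mB B0); last first.
    by move=> t _; rewrite lee_fin sqr_ge0.
  rewrite integral_mkcond [RHS]integral_mkcond; apply: eq_integral => t _.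
  rewrite !patchE /ut mem_setE in_itv/=.
  case: (boolP (t \in _ `\` _)) => [|_]; last by rewrite linear0; case: ifP.
  rewrite inE => -[+ _]; rewrite /= in_itv/= => /andP[_ tT].
  by rewrite (ltW tT) (sqr_energy_norm a0).
have fE : ((prim (fun t => 2 * wt t (ut t) + F (ut t) (ut t)) T)%:E <=
    sqr_L2norm T (dual_norm (energy_norm F)) f)%E.
  rewrite prim_fin// integralE /sqr_L2norm.
  rewrite [leRHS](@ge0_integral_setD_null _ _ _ lebesgue_measure _ B _ mB B0); last first.
    by move=> t _; rewrite lee_fin sqr_ge0.
  (* The integrand on the left has no sign, whereas monotonicity against the possibly nonmeasurable
     norm of [f] is available for nonnegative functions; hence the positive part. *)
  apply: (@le_trans _ _ (\int[lebesgue_measure]_(t in `]-oo, T])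
      ((fun t => (2 * wt t (ut t) + F (ut t) (ut t))%:E)^\+ t))%E).
    by apply: geeDl; rewrite oppe_le0 integral_ge0.
  rewrite [leLHS]integral_mkcond [leRHS]integral_mkcond.
  apply: ge0_le_integral_nonmeasurable => t _; rewrite !patchE.
    by case: ifP.
  rewrite funeposE /wt /ut; case: (boolP (t \in _ `\` _)) => [|_]; last first.
    by rewrite !linear0 mulr0 addr0 maxxx; case: ifP.
  rewrite inE => -[tT tB].
  have wE : w t = f t - F (u t).
    apply/eqP; rewrite eq_sym subr_eq eq_sym; apply/eqP; apply: contrapT => ne; apply: tB.
    by right; apply: eqE => /(_ tT).
  have h : 2 * w t (u t) + F (u t) (u t) <= dual_norm (energy_norm F) (f t) ^+ 2.
    by apply: le_trans (le_energy_dual a0 Fa (f t) (u t)); rewrite wE.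
  case: ifP => _; last by rewrite lee_fin sqr_ge0.
  by rewrite ge_max !lee_fin h sqr_ge0.
rewrite (primD T (causalZ 2 cwu) cFu) (primZ 2 T cwu) in fE.
move=> coreE; rewrite fracint_cst ?sqr_ge0// uE.
apply: le_trans (leeD2r _ coreE) _.
apply: le_trans _ (leeD2l _ fE).
by rewrite -!EFinD lee_fin addrA.
Qed.
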